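(* Let $G=(V,E)$ be a directed graph with a legal partition $V_1,\dots,V_m$ of $V$, index sets $U_1,U_2$ and $U_1=U_1^S\sqcup U_1^{\overline S}$. Consider the two-level online stochastic mirror descent algorithm described in the context with the potentials $$\Psi(\mathbf y)=\sum_{\bar k\in U_2}\frac{-\sqrt{\mathbf y(\bar k)}}{\eta}+\sum_{\bar k\in U_1^S}\frac{-\sqrt{\mathbf y(\bar k)}}{\eta_S}+\sum_{\bar k\in U_1^{\overline S}}\frac{\mathbf y(\bar k)\log\mathbf y(\bar k)}{\eta_{\overline S}},\qquad \Phi_{\bar k}(\mathbf x)=\sum_{j=1}^{n_{\bar k}}\mathbf x(j)\log\mathbf x(j)\quad(\bar k\in U_2).$$ Then for all sufficiently large $T>0$ there is a choice of $\eta,\eta_S,\eta_{\overline S}>0$, of the learning rates $\eta_{\bar k}$ and of the exploration factors (depending only on $G$, the partition and $T$) such that for every loss sequence $\ell^{(1)},\dots,\ell^{(T)}$ and every arm $a^*=(\bar k^*,j^* )$, the regret $R_{(\bar k^*,j^* )}(T)$ of the algorithm with respect to $a^*$ is at most: (1) if $U_2=\emptyset$ and $U_1^{\overline S}=\emptyset$: $\;2\sqrt{2|U_1^S|}\,T^{\frac12}$; (2) if $U_2=\emptyset$ and $U_1^{\overline S}\ne\emptyset$: $\;4\sqrt{6|U_1^S|}\,T^{\frac12}+2\sqrt{10\log(|U_1^{\overline S}|+1)}\,T^{\frac12}+T^{\frac12}$; (3) if $U_2\ne\emptyset$ and $U_1^{\overline S}=\emptyset$: $$3\cdot2^{\frac23}\Big(|U_2|\sum_{\bar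 k\in U_2}(\delta^*_{\bar k})^2\Big)^{\frac16}T^{\frac23}+\frac{3}{2^{1/3}}\Big(\sum_{\bar k\in U_2}\delta^*_{\bar k}\log n_{\bar k}\Big)^{\frac13}T^{\frac23}+4\sqrt{|U_1^S|}\,T^{\frac12};$$ (4) if $U_2\ne\emptyset$ and $U_1^{\overline S}\ne\emptyset$: $$6\cdot2^{\frac13}\Big(|U_2|\sum_{\bar k\in U_2}(\delta^*_{\bar k})^2\Big)^{\frac16}T^{\frac23}+\frac{3}{2^{1/3}}\Big(\sum_{\bar k\in U_2}\delta^*_{\bar k}\log n_{\bar k}\Big)^{\frac13}T^{\frac23}+\frac{\sqrt6}{3}T^{\frac12}+4\sqrt{6|U_1^S|}\,T^{\frac12}+2\sqrt{10\log(|U_1^{\overline S}|+1)}\,T^{\frac12}+\frac{4\,T^{\frac13}|U_2|^{\frac56}}{2^{\frac13}\big(\sum_{\bar k\in U_2}(\delta^*_{\bar k})^2\big)^{\frac16}}.$$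
   Context: **Problem (bandit with graph feedback).** $G=(V,E)$ is a finite directed graph, possibly with self-loops; vertices are called arms. $N_{\mathrm{in}}(v)=\{u:(u,v)\in E\}$, $N_{\mathrm{out}}(v)=\{u:(v,u)\in E\}$. The player knows $G$ and the horizon $T$. In each round $t=1,\dots,T$ the player computes (from past observations) a distribution on $V$ and samples an arm $A_t$ from it; there is a loss vector $\ell^{(t)}:V\to[0,1]$; the player pays $\ell^{(t)}(A_t)$ and observes exactly the values $\ell^{(t)}(v)$ for $v\in N_{\mathrm{out}}(A_t)$. For a fixed loss sequence and an arm $a$, $R_a(T)=\mathbf E[\sum_{t=1}^T\ell^{(t)}(A_t)]-\sum_{t=1}^T\ell^{(t)}(a)$. **Observability.** A vertex $v$ is observable if $N_{\mathrm{in}}(v)\ne\emptyset$; a graph is observable if all its vertices are. A vertex is strongly observable if it has a self-loop or $N_{\mathrm{in}}(v)=V\setminus\{v\}$. **Legal partition.** $G$ is observable, and $V_1,\dots,V_m$ is a partition of $V$ into nonempty blocks, $n_{\bar k}=|V_{\bar k}|$, with $[m]=U_1\sqcup U_2$, $U_1=\{1,\dots,s\}$, $U_2=\{s+1,\dots,m\}$ ($s=0$ allowed), such that: $n_{\bar k}=1$ for $\bar k\in U_1$ and the unique vertex of $V_{\bar k}$ is strongly observable in $G$; $n_{\bar k}>1$ for $\bar k\in U_2$ and the induced subgraph $G_{\bar k}=G[V_{\bar k}]$ is observable. $U_1^S\subseteq U_1$ is the set of indices whose vertex has a self-loop, $U_1^{\overline S}=U_1\setminus U_1^S$. The $j$-th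 arm of $V_{\bar k}$ is written $(\bar k,j)$. For $\bar k\in U_2$, $\delta^*_{\bar k}$ is the optimum of the linear program: minimize $\sum_{v\in V_{\bar k}}x_v$ subject to $\sum_{v\in N_{\mathrm{in}}(u)\cap V_{\bar k}}x_v\ge1$ for all $u\in V_{\bar k}$ and $0\le x_v\le1$. **Algorithm.** $\Delta_{n-1}$ is the probability simplex in $\mathbb R^n$, $B_F(\mathbf x,\mathbf y)=F(\mathbf x)-F(\mathbf y)-\langle\nabla F(\mathbf y),\mathbf x-\mathbf y\rangle$. Parameters: potentials $\Psi$ and $\Phi_{\bar k}$ ($\bar k\in U_2$); learning rates $\eta_{\bar k}>0$ ($\bar k\in U_2$); global exploration factors $\gamma^{(t)}((\bar k,j))\in[0,1]$ for all arms, $\overline\gamma^{(t)}=\sum_{\bar k,j}\gamma^{(t)}((\bar k,j))\le1$; local exploration factors $\gamma^{(t)}_{\bar k}(j)\in[0,1]$ for $\bar k\in U_2$, $\overline\gamma^{(t)}_{\bar k}=\sum_j\gamma^{(t)}_{\bar k}(j)\le1$. Initialize $Y^{(1)}=\arg\min_{\Delta_{m-1}}\Psi$, $X^{(1)}_{\bar k}=\arg\min_{\Delta_{n_{\bar k}-1}}\Phi_{\bar k}$ for $\bar k\in U_2$, and $X^{(t)}_{\bar k}=1$ for all $t$ if $\bar k\in U_1$. In round $t$: - for $\bar k\in U_2$, $\tilde X^{(t)}_{\bar k}(j)=(1-\overline\gamma^{(t)}_{\bar k})X^{(t)}_{\bar k}(j)+\gamma^{(t)}_{\bar k}(j)$ and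 $Z^{(t)}((\bar k,j))=(1-\overline\gamma^{(t)})Y^{(t)}(\bar k)\tilde X^{(t)}_{\bar k}(j)+\gamma^{(t)}((\bar k,j))$; for $\bar k\in U_1$, $Z^{(t)}((\bar k,1))=(1-\overline\gamma^{(t)})Y^{(t)}(\bar k)+\gamma^{(t)}((\bar k,1))$; - play $A_t\sim Z^{(t)}$, observe, and set $\hat\ell^{(t)}_{\bar k}(j)=\dfrac{\mathbf 1[(\bar k,j)\in N_{\mathrm{out}}(A_t)]}{\sum_{a\in N_{\mathrm{in}}((\bar k,j))}Z^{(t)}(a)}\,\ell^{(t)}((\bar k,j))$; - set $\widehat L^{(t)}(\bar k)=\sum_{j}\tilde X^{(t)}_{\bar k}(j)\hat\ell^{(t)}_{\bar k}(j)$ for $\bar k\in U_2$, $\widehat L^{(t)}(\bar k)=\hat\ell^{(t)}_{\bar k}(1)$ for $\bar k\in U_1$; $c^{(t)}=\sum_{\bar k\in U_1^{\overline S}}\widehat L^{(t)}(\bar k)Y^{(t)}(\bar k)$; $(\widehat L^{(t)})'=\widehat L^{(t)}-c^{(t)}\mathbf 1^{[m]}$ (with $\mathbf 1^{[m]}$ the all-ones vector); - update $X^{(t+1)}_{\bar k}=\arg\min_{\mathbf x\in\Delta_{n_{\bar k}-1}}\eta_{\bar k}\langle\mathbf x,\hat\ell^{(t)}_{\bar k}\rangle+B_{\Phi_{\bar k}}(\mathbf x,X^{(t)}_{\bar k})$ for $\bar k\in U_2$, and $Y^{(t+1)}=\arg\min_{\mathbf y\in\Delta_{m-1}}\langle\mathbf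 y,(\widehat L^{(t)})'\rangle+B_\Psi(\mathbf y,Y^{(t)})$. *)

(* Defs.v *)
From mathcomp Require Import all_boot all_order all_algebra.
From mathcomp Require Import all_classical all_reals all_analysis.

Set Implicit Arguments.
Unset Strict Implicit.
Unset Printing Implicit Defensive.

Import Order.TTheory GRing.Theory Num.Theory.
Import numFieldNormedType.Exports.

Local Open Scope classical_set_scope.
Local Open Scope ring_scope.

Section ConvexAnalysis.
Context {R : realType} {I : finType}.
Implicit Types (F : (I -> R) -> R) (x y : I -> R) (A : {set I}).

(* The probability simplex of R^A: a vector of R^A is encoded as a function on
   the whole index type I that vanishes outside A. *)
Definition simplex A : set (I -> R) :=
  [set x | [/\ forall i, 0 <= x i,
               forall i, i \notin A -> x i = 0
             & \sum_(i in A) x i = 1]].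

Definition inner x y : R := \sum_i x i * y i.

Definition grad F y : I -> R :=
  fun i => derive1 (fun h : R => F [eta y with i |-> h]) (y i).

Definition bregman F x y : R :=
  F x - F y - inner (grad F y) (fun i => x i - y i).

(* A minimizer of F on S; the junk value 0 is returned only if F does not
   attain its minimum on S. *)
Definition argmin (S : set (I -> R)) F : I -> R :=
  xget (fun=> 0) [set x | S x /\ forall y, S y -> F x <= F y].

End ConvexAnalysis.

Section Graph.
Context {V : finType}.
Implicit Types (E : rel V) (v : V).

Definition Nin E v : {set V} := [set u | E u v]%SET.
Definition Nout E v : {set V} := [set u | E v u]%SET.

(* Every vertex of the induced subgraph E[W] is observable in E[W]; taking for W
   the full set gives the observability of E itself. *)
Definition observable_on E (W : {set V}) : Prop :=
  forall v, v \in W -> (Nin E v :&: W != finset.set0)%SET.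

Definition strongly_observable E v : Prop :=
  E v v \/ Nin E v = [set~ v]%SET.

End Graph.

(* A partition of V into m indexed blocks is encoded by the map blk sending a
   vertex to the index of its block. Indices start at 0, so that the first s
   indices (those of U1) are the k < s. *)
Section Partition.
Context {V : finType} {m : nat}.
Variables (E : rel V) (s : nat) (blk : V -> 'I_m).

Definition block (k : 'I_m) : {set V} := [set v | blk v == k]%SET.

Definition U1 : {set 'I_m} := [set k : 'I_m | (k < s)%N]%SET.
Definition U2 : {set 'I_m} := [set k : 'I_m | (s <= k)%N]%SET.

Definition U1S : {set 'I_m} :=
  [set k in U1 | [exists v in block k, E v v]]%SET.
Definition U1NS : {set 'I_m} := (U1 :\: U1S)%SET.

Definition legal_partition : Prop :=
  [/\ observable_on E [set: V]%SET,
      (s <= m)%N,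
      forall k, block k != finset.set0,
      forall k, k \in U1 ->
        #|block k| = 1%N /\ forall v, v \in block k -> strongly_observable E v
    & forall k, k \in U2 ->
        (1 < #|block k|)%N /\ observable_on E (block k)].

(* For k in U2 the program is feasible (x = 1) and its optimum is this inf. *)
Definition delta_star (R : realType) (k : 'I_m) : R :=
  inf [set \sum_(v in block k) x v | x in
    [set x : V -> R |
      (forall u, u \in block k -> 1 <= \sum_(v in Nin E u :&: block k) x v)
      /\ (forall v, v \in block k -> 0 <= x v <= 1)]].

End Partition.

Arguments delta_star {V m} E blk R k.

(* Rounds are numbered from 0: round t of the code is round t + 1 in the usual
   numbering. *)
Record params (R : realType) (V : finType) (m : nat) := Params {
  eta : R;
  eta_S : R;
  eta_NS : R;
  eta_loc : 'I_m -> R;     (* used on U2 only *)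
  gam : nat -> V -> R;     (* global exploration factors *)
  gam_loc : nat -> V -> R  (* gam_loc t v is the local factor of v in its own
                              block; used on the blocks of U2 only *)
}.

Section Algorithm.
Context {R : realType} {V : finType} {m : nat}.
Variables (E : rel V) (s : nat) (blk : V -> 'I_m).

Local Notation block := (block blk).
Local Notation U1 := (@U1 m s).
Local Notation U2 := (@U2 m s).
Local Notation U1S := (U1S E s blk).
Local Notation U1NS := (U1NS E s blk).

Definition valid_params (p : params R V m) : Prop :=
  [/\ [/\ 0 < eta p, 0 < eta_S p & 0 < eta_NS p],
      forall k, k \in U2 -> 0 < eta_loc p k,
      forall t, (forall v, 0 <= gam p t v <= 1) /\ \sum_v gam p t v <= 1
    & forall t k, k \in U2 ->
        (forall v, v \in block k -> 0 <= gam_loc p t v <= 1)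
        /\ \sum_(v in block k) gam_loc p t v <= 1].

Definition Psi (p : params R V m) (y : 'I_m -> R) : R :=
  \sum_(k in U2) - Num.sqrt (y k) / eta p
  + \sum_(k in U1S) - Num.sqrt (y k) / eta_S p
  + \sum_(k in U1NS) y k * ln (y k) / eta_NS p.

(* Since ln 0 = 0 in the library, 0 log 0 = 0 here and in Psi. *)
Definition Phi (k : 'I_m) (x : V -> R) : R :=
  \sum_(v in block k) x v * ln (x v).

(* dist_Y is a point of the simplex of R^m; dist_X k is a point of the simplex
   of R^(V_k), that is, a function on V vanishing outside V_k. *)
Record state := State {
  dist_Y : 'I_m -> R;
  dist_X : 'I_m -> V -> R
}.

Variable p : params R V m.

Definition init_state : state := {|
  dist_Y := argmin (simplex [set: 'I_m]%SET) (Psi p);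
  dist_X := fun k =>
    if k \in U2 then argmin (simplex (block k)) (Phi k)
    else fun v => (v \in block k)%:R
|}.

Definition Xtilde (t : nat) (st : state) (k : 'I_m) (v : V) : R :=
  (1 - \sum_(u in block k) gam_loc p t u) * dist_X st k v + gam_loc p t v.

Definition Z (t : nat) (st : state) (v : V) : R :=
  let k := blk v in
  let gbar := \sum_u gam p t u in
  if k \in U2 then (1 - gbar) * dist_Y st k * Xtilde t st k v + gam p t v
  else (1 - gbar) * dist_Y st k + gam p t v.

(* ell is the loss vector of the round and a the arm played. Only the values of
   ell on Nout E a matter. *)
Definition ellhat (t : nat) (st : state) (ell : V -> R) (a : V) (v : V) : R :=
  (v \in Nout E a)%:R / (\sum_(u in Nin E v) Z t st u) * ell v.

(* For k in U1 the last sum has a single term. *)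
Definition Lhat (t : nat) (st : state) (ell : V -> R) (a : V) (k : 'I_m) : R :=
  if k \in U2 then
    \sum_(v in block k) Xtilde t st k v * ellhat t st ell a v
  else \sum_(v in block k) ellhat t st ell a v.

Definition Lhat' (t : nat) (st : state) (ell : V -> R) (a : V) (k : 'I_m) : R :=
  let c := \sum_(i in U1NS) Lhat t st ell a i * dist_Y st i in
  Lhat t st ell a k - c.

Definition next_state (t : nat) (st : state) (ell : V -> R) (a : V) : state := {|
  dist_Y := argmin (simplex [set: 'I_m]%SET)
    (fun y => inner y (Lhat' t st ell a) + bregman (Psi p) y (dist_Y st));
  dist_X := fun k =>
    if k \in U2 then
      argmin (simplex (block k))
        (fun x => eta_loc p k * inner x (ellhat t st ell a)
                  + bregman (Phi k) x (dist_X st k))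
    else fun v => (v \in block k)%:R
|}.

(* The state at the beginning of the round following the plays in h, listed from
   the most recent one to the oldest. *)
Fixpoint state_after (ell : nat -> V -> R) (h : seq V) : state :=
  if h is a :: h' then
    next_state (size h') (state_after ell h') (ell (size h')) a
  else init_state.

(* The joint law of the arms (A_0, ..., A_(T-1)): conditionally on the past,
   A_t is drawn from the distribution Z of round t. *)
Definition path_law (ell : nat -> V -> R) (T : nat) (w : T.-tuple V) : R :=
  \prod_(t < T) Z t (state_after ell (rev (take t w))) (tnth w t).

Definition regret (ell : nat -> V -> R) (T : nat) (a : V) : R :=
  \sum_(w : T.-tuple V) path_law ell w * (\sum_(t < T) ell t (tnth w t))
  - \sum_(t < T) ell t a.

End Algorithm.

(* Main.v *)
(** Both levels are instances of mirror descent for a separable potential whose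
coordinates are [- sqrt x / e] or [x log x / e]. For such potentials the
minimizer on the simplex is the unique point whose shifted gradient is constant,
which gives an exact identity for the linear regret of a step: a decrease of the
Bregman divergence to the comparator plus a stability term, which is a sum over
the coordinates and is insensitive to adding a constant to the losses. The sum of
the two divergences is a Lyapunov function, and the theorem follows by summing
its expected decrease over the rounds.

The stability terms of a block of [U2] are controlled by the local exploration,
proportional to an optimal solution of its linear program: the loss estimates of
block [k] then have variance at most of order [1 / (Y k * r k)], and
[sum_k sqrt (Y k) / r k] is bounded by Cauchy-Schwarz. A vertex without self-loop
is harmful only when it is played with probability above 1/2; there is at most
one such vertex, and its estimate is subtracted from all the losses. *)
Require Import Defs.
From mathcomp Require Import all_boot all_order all_algebra.
From mathcomp Require Import all_classical all_reals all_analysis.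
From mathcomp Require Import ring lra.

Set Implicit Arguments.
Unset Strict Implicit.
Unset Printing Implicit Defensive.

Import Order.TTheory GRing.Theory Num.Theory.
Import numFieldNormedType.Exports.
Local Open Scope ring_scope.

(** * One-dimensional potentials *)

Section Coordinate.
Context {R : realType}.
Implicit Types (b : bool) (e x y c l s : R).

(** The square root is used where an estimate can have variance of order [1 / y]: its stability
    weight [y * sqrt y] leaves [sqrt y], whose sum costs no logarithm. A vertex without self-loop
    played with probability at most 1/2 is observed with probability at least 1/2, so the entropy,
    with weight [y], suffices there and costs only the logarithm of the number of such vertices.

    Subtracting an estimate makes losses negative, and both stability bounds then need the rate
    times the shift to be below a constant. The shift can reach [1 / (1 - z v)]: hence the coupling
    [explore_others] of rates and exploration, one reason why [T] has to be large. Its second moment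
    is of the same order, but the other coordinates carry mass of order [1 - z v].

    Inside a block of [U2] local exploration is not enough: the variance [1 / (Y k * r k)] blows up
    when [Y k] is tiny, which may happen for the block of the comparator. Global exploration bounds
    the variance there without [Y k]; its cost, linear in [T], is what leads to [T ^ (2 / 3)]. *)

Definition cpot b e x : R :=
  if b then - Num.sqrt x / e else x * ln x / e.

Definition cgrad b e y : R :=
  if b then - (2 * e * Num.sqrt y)^-1 else (ln y + 1) / e.

(** These closed forms of the Bregman divergence make sense at [x = 0], where the potentials are not
    differentiable; only the base point [y] has to be positive. *)
Definition cbreg b e x y : R :=
  if b then (Num.sqrt x - Num.sqrt y) ^+ 2 / (2 * e * Num.sqrt y)
  else (x * (ln x - ln y) - x + y) / e.

Lemma cpot_taylor b e x y : 0 < e -> 0 <= x -> 0 < y ->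
  cpot b e x = cpot b e y + cgrad b e y * (x - y) + cbreg b e x y.
Proof.
move=> e0 x0 y0; rewrite /cpot /cgrad /cbreg; case: b; last by field; rewrite gt_eqF.
have sy : 0 < Num.sqrt y by rewrite sqrtr_gt0.
rewrite -[in X in (X - _)](sqr_sqrtr x0) -[in X in (_ - X)](sqr_sqrtr (ltW y0)).
by field; rewrite !gt_eqF.
Qed.

(** Reduces nonnegativity and definiteness of the divergence to [1 + u <= expR u], which is strict
    for [u] nonzero. *)
Lemma entropy_breg x y : 0 < x -> 0 < y ->
  x * (ln x - ln y) - x + y = x * (expR (ln y - ln x) - (1 + (ln y - ln x))).
Proof.
by move=> x0 y0; rewrite expRB !lnK ?posrE//; field; rewrite gt_eqF.
Qed.

Lemma cbreg_ge0 b e x y : 0 < e -> 0 <= x -> 0 < y -> 0 <= cbreg b e x y.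
Proof.
move=> e0 x0 y0; rewrite /cbreg; case: b.
  by rewrite divr_ge0 ?sqr_ge0// mulr_ge0 ?sqrtr_ge0// mulr_ge0// ltW.
rewrite divr_ge0 ?(ltW e0)//.
move: x0; rewrite le_eqVlt => /orP[/eqP<-|x0]; first by rewrite mul0r subr0 add0r ltW.
by rewrite entropy_breg// mulr_ge0 ?(ltW x0)// subr_ge0 expR_ge1Dx.
Qed.

Lemma cbreg_eq0 b e x y : 0 < e -> 0 <= x -> 0 < y -> cbreg b e x y = 0 -> x = y.
Proof.
move=> e0 x0 y0; rewrite /cbreg; case: b.
  have sy : 0 < Num.sqrt y by rewrite sqrtr_gt0.
  have d0 : 0 < 2 * e * Num.sqrt y by rewrite !mulr_gt0.
  move/eqP; rewrite mulf_eq0 invr_eq0 (gt_eqF d0) orbF sqrf_eq0 subr_eq0 => /eqP sxy.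
  by rewrite -(sqr_sqrtr x0) sxy sqr_sqrtr// ltW.
move/eqP; rewrite mulf_eq0 invr_eq0 (gt_eqF e0) orbF.
move: x0; rewrite le_eqVlt => /orP[/eqP<-|x0].
  by rewrite mul0r subr0 add0r gt_eqF.
rewrite entropy_breg// mulf_eq0 gt_eqF//= subr_eq0 => /eqP h.
have [d0|/expR_gt1Dx] := eqVneq (ln y - ln x) 0; last by rewrite h ltxx.
by apply: ln_inj; rewrite ?posrE//; lra.
Qed.

Lemma is_derive_cpot b e y : 0 < y -> is_derive y 1 (cpot b e) (cgrad b e y).
Proof.
move=> y0; rewrite /cpot /cgrad; case: b.
  have -> : (fun x => - Num.sqrt x / e) = (- e^-1) \*: (@Num.sqrt R).
    by apply/funext => x /=; rewrite /GRing.scale /= mulrC mulNr mulrN.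
  have sy := is_derive1_sqrt y0.
  apply: is_derive_eq; rewrite /GRing.scale /= !invfM; ring.
have -> : (fun x => x * ln x / e) = e^-1 \*: ((@id R) * (@ln R)).
  by apply/funext => x /=; rewrite /GRing.scale /= mulrC.
have sy := is_derive1_ln y0.
apply: is_derive_eq; rewrite /GRing.scale /= mulr1 divff ?gt_eqF//; ring.
Qed.

(** The function [expR x - x - x ^+ 2 / 2] equals 1 at 0, and its derivative [expR z - 1 - z] is
    nonnegative. *)
Lemma expR_ge_quadratic x : 0 <= x -> 1 + x + x ^+ 2 / 2 <= expR x.
Proof.
rewrite le_eqVlt => /predU1P[<-|x0]; first by rewrite expR0 expr0n/= mul0r !addr0.
have dg (z : R) : is_derive z 1 (@expR R - id - 2^-1 \*: (@id R ^+ 2)) (expR z - 1 - z).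
  have h := is_derive_expR z.
  by apply: is_derive_eq; rewrite /GRing.scale /= expr1; field.
have [|c _] := MVT x0 (fun z _ => dg z).
  by apply: derivable_within_continuous => w _; case: (dg w).
rewrite subr0 !fctE /= /GRing.scale /= expR0 => e.
have : 0 <= (expR c - 1 - c) * x.
  by rewrite mulr_ge0 ?(ltW x0)//; have := expR_ge1Dx c; lra.
by rewrite -e !expr2; lra.
Qed.

Lemma expRN_le_quadratic x : 0 <= x -> expR (- x) <= 1 - x + x ^+ 2 / 2.
Proof.
move=> x0; have h := expR_ge_quadratic x0.
have x2 := sqr_ge0 x.
have p : 0 < 1 - x + x ^+ 2 / 2 by have := sqr_ge0 (x - 1); nra.
rewrite expRN -[leLHS]mulr1 ler_pdivrMl ?expR_gt0//.
(* The product equals [1 + x ^+ 4 / 4]. *)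
apply: (@le_trans _ _ ((1 + x + x ^+ 2 / 2) * (1 - x + x ^+ 2 / 2))).
  by have := sqr_ge0 (x ^+ 2); nra.
by apply: ler_wpM2r => //; exact: ltW.
Qed.

Lemma expR_le_quadratic x : 0 <= x <= 2^-1 -> expR x <= 1 + x + 2 * x ^+ 2.
Proof.
move=> /andP[x0 x1]; have h := expR_ge1Dx (- x).
have p : 0 < 1 - x by lra.
rewrite -[x]opprK expRN opprK -[leLHS]mulr1 ler_pdivrMl ?expR_gt0//.
(* The product equals [1 + x ^+ 2 * (1 - 2 * x)], whence the range up to 1/2. *)
apply: (@le_trans _ _ ((1 - x) * (1 + x + 2 * x ^+ 2))); first by nra.
by apply: ler_wpM2r => //; nra.
Qed.

(** With [a = sqrt y], [v = a - sqrt y'], [d = l - s] and [k = 1 / (2 * e * a)], the left side is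
    [2 * a * v * d - d * v ^+ 2 - k * v ^+ 2]. If [d >= 0] the middle term helps, and completing the
    square gives [a ^+ 2 * d ^+ 2 / k]. If [d < 0] it hurts, but [- d <= s <= k / 2], so half of the
    divergence absorbs it at the price of a factor 2. *)
Lemma stability_sqrt e y y' l s : 0 < e -> 0 < y -> 0 <= y' -> 0 <= l -> 0 <= s ->
    4 * e * Num.sqrt y * s <= 1 ->
  (l - s) * (y - y') - cbreg true e y' y
    <= 2 * e * (y * Num.sqrt y) * l ^+ 2 + 4 * e * (y * Num.sqrt y) * s ^+ 2.
Proof.
move=> e0 y0 y'0 l0 s0; rewrite /cbreg.
have : 0 < Num.sqrt y by rewrite sqrtr_gt0.
have := sqr_sqrtr (ltW y0); have := sqr_sqrtr y'0; have := sqrtr_ge0 y'.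
set a := Num.sqrt y; set r := Num.sqrt y' => r0 <- <- a0 hs.
set d := l - s; have -> : r - a = - (a - r) by ring.
set v := a - r; have -> : a ^+ 2 - r ^+ 2 = v * (2 * a - v) by rewrite /v; ring.
set k := (2 * e * a)^-1; have k0 : 0 < k by rewrite invr_gt0 !mulr_gt0.
have ek : 2 * e * a = k^-1 by rewrite invrK.
have e1 : 2 * e * (a ^+ 2 * a) = a ^+ 2 / k by rewrite -ek; ring.
have e2 : 4 * e * (a ^+ 2 * a) = 2 * (a ^+ 2 / k) by rewrite -ek; ring.
rewrite e1 e2.
have sk : s <= k / 2.
  have -> : s = (k * (4 * e * a * s)) / 2.
    by rewrite /k; field; rewrite !gt_eqF.
  by rewrite ler_pM2r// ler_piMr// ltW.
set q := a ^+ 2 / k.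
have q0 : 0 <= q by rewrite divr_ge0// ?sqr_ge0// ltW.
have key : 0 <= q * d ^+ 2 - 2 * (a * v * d) + k * v ^+ 2.
  have -> : q * d ^+ 2 - 2 * (a * v * d) + k * v ^+ 2 = (a * d - k * v) ^+ 2 / k.
    by rewrite /q; field; rewrite gt_eqF.
  by rewrite divr_ge0 ?sqr_ge0 ?ltW.
have key2 : 0 <= 2 * q * d ^+ 2 - 2 * (a * v * d) + k / 2 * v ^+ 2.
  have -> : 2 * q * d ^+ 2 - 2 * (a * v * d) + k / 2 * v ^+ 2
          = (2 * a * d - k * v) ^+ 2 / (2 * k).
    by rewrite /q; field; rewrite gt_eqF.
  by rewrite divr_ge0 ?sqr_ge0 ?mulr_ge0 ?ltW.
have v2 := sqr_ge0 v.
have [d0|d0] := lerP 0 d.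
  have dl : d ^+ 2 <= l ^+ 2 by rewrite lerXn2r ?nnegrE// /d gerBl.
  have : q * d ^+ 2 <= q * l ^+ 2 by rewrite ler_wpM2l.
  have : 0 <= 2 * q * s ^+ 2 by rewrite mulr_ge0 ?sqr_ge0// mulr_ge0.
  have : 0 <= d * v ^+ 2 by rewrite mulr_ge0.
  by nra.
have ds : d ^+ 2 <= s ^+ 2.
  by rewrite -sqrrN lerXn2r ?nnegrE//; rewrite /d in d0 *; lra.
have : 2 * q * d ^+ 2 <= 2 * q * s ^+ 2 by rewrite ler_wpM2l// mulr_ge0.
have : 0 <= q * l ^+ 2 by rewrite mulr_ge0 ?sqr_ge0.
have : 0 <= (d + k / 2) * v ^+ 2.
  by rewrite mulr_ge0//; rewrite /d in d0 *; lra.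
by nra.
Qed.

(** With [d = l - s], the left side is largest at [y' = y * expR (- (e * d))], where it equals
    [y * (expR (- (e * d)) - 1 + e * d) / e]. The quadratic bounds on the exponential conclude, with
    the better constant when [d >= 0]. *)
Lemma stability_entropy e y y' l s : 0 < e -> 0 < y -> 0 <= y' -> 0 <= l -> 0 <= s ->
    e * s <= 2^-1 ->
  (l - s) * (y - y') - cbreg false e y' y
    <= e / 2 * y * l ^+ 2 + 2 * e * y * s ^+ 2.
Proof.
move=> e0 y0 y'0 l0 s0 hs; rewrite /cbreg.
set d := l - s.
have young : y' * (1 - (ln y' - ln y) - e * d) <= y * expR (- (e * d)).
  move: y'0; rewrite le_eqVlt => /orP[/eqP<-|y'0].
    by rewrite mul0r mulr_ge0 ?expR_ge0// ltW.
  have := expR_ge1Dx (- (e * d) - (ln y' - ln y)).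
  rewrite opprB expRD expRB !lnK ?posrE// => h.
  have -> : y * expR (- (e * d)) = y' * (expR (- (e * d)) * (y / y')).
    by field; rewrite gt_eqF.
  by rewrite ler_pM2l//; lra.
have -> : d * (y - y') - (y' * (ln y' - ln y) - y' + y) / e =
   (y' * (1 - (ln y' - ln y) - e * d) - y * (1 - e * d)) / e.
  by field; rewrite gt_eqF.
rewrite ler_pdivrMr//; apply: (@le_trans _ _ (y * (expR (- (e * d)) - 1 + e * d))).
  by nra.
have -> : (e / 2 * y * l ^+ 2 + 2 * e * y * s ^+ 2) * e
   = y * ((e * l) ^+ 2 / 2 + 2 * (e * s) ^+ 2) by ring.
rewrite ler_pM2l//.
have [d0|d0] := lerP 0 d.
  have ed : 0 <= e * d by rewrite mulr_ge0// ltW.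
  have h := expRN_le_quadratic ed.
  have : (e * d) ^+ 2 <= (e * l) ^+ 2.
    by rewrite lerXn2r ?nnegrE ?(mulr_ge0 (ltW e0))// ler_pM2l// /d gerBl.
  have := sqr_ge0 (e * s); lra.
have ed : 0 <= - (e * d) <= 2^-1.
  by apply/andP; split; rewrite /d in d0 *; nra.
have h := expR_le_quadratic ed.
have : (- (e * d)) ^+ 2 <= (e * s) ^+ 2.
  rewrite lerXn2r ?nnegrE ?(mulr_ge0 (ltW e0))//; first by case/andP: ed.
  by rewrite -mulrN ler_pM2l// /d; lra.
have := sqr_ge0 (e * l); lra.
Qed.

End Coordinate.

(** * Mirror descent for separable potentials *)

Section SeparablePotential.
Context {R : realType} {I : finType}.
Variables (A : {set I}) (b : I -> bool) (e : I -> R).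
Hypothesis e_gt0 : forall i, i \in A -> 0 < e i.
Implicit Types (x y : I -> R).

Definition seppot x : R := \sum_(i in A) cpot (b i) (e i) (x i).

Definition sepbreg x y : R := \sum_(i in A) cbreg (b i) (e i) (x i) (y i).

Definition simplex_interior y := simplex A y /\ forall i, i \in A -> 0 < y i.

Lemma sepbreg_ge0 x y : simplex A x -> simplex_interior y -> 0 <= sepbreg x y.
Proof.
move=> [x0 _ _] [_ y0]; apply: sumr_ge0 => i iA.
by apply: cbreg_ge0; [exact: e_gt0|exact: x0|exact: y0].
Qed.

Lemma grad_seppot y i : simplex_interior y ->
  grad seppot y i = if i \in A then cgrad (b i) (e i) (y i) else 0.
Proof.
move=> [_ y0]; rewrite /grad derive1E; case: ifPn => iA; last first.
  have -> : (fun h : R => seppot [eta y with i |-> h]) = cst (seppot y).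
    apply/funext => h; apply: eq_bigr => j jA /=.
    by case: eqP => // ji; rewrite -ji jA in iA.
  exact: derive_cst.
have -> : (fun h : R => seppot [eta y with i |-> h]) =
    cpot (b i) (e i) + cst (\sum_(j in A | j != i) cpot (b j) (e j) (y j)).
  apply/funext => h; rewrite /seppot (bigD1 i)//= eqxx; congr +%R.
  by apply: eq_bigr => j /andP[_ /negPf ->].
have h := is_derive_cpot (b i) (e i) (y0 i iA).
by rewrite derive_val addr0.
Qed.

Lemma bregman_seppot x y : simplex A x -> simplex_interior y ->
  bregman seppot x y = sepbreg x y.
Proof.
move=> [x0 xA _] yint; have [[_ yA _] y0] := yint.
rewrite /bregman /inner (bigID (mem A))/= [X in _ - (_ + X)]big1 ?addr0; last first.
  by move=> i iA; rewrite xA// yA// subrr mulr0.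
rewrite /seppot /sepbreg -!sumrB; apply: eq_bigr => i iA.
rewrite grad_seppot// iA (cpot_taylor (b i) (e_gt0 iA) (x0 i) (y0 i iA)); ring.
Qed.

(* The point where the derivative of the potential of a coordinate, shifted by
   [c], equals [l]. *)
Definition kkt_coord i (c l : R) : R :=
  if b i then ((2 * e i * (c - l)) ^+ 2)^-1 else expR (e i * (l - c) - 1).

Lemma kkt_coordK i (c y : R) : 0 < e i -> 0 < y ->
  kkt_coord i c (c + cgrad (b i) (e i) y) = y.
Proof.
move=> ei y0; rewrite /kkt_coord /cgrad; case: (b i).
  have sy : 0 < Num.sqrt y by rewrite sqrtr_gt0.
  have -> : 2 * e i * (c - (c - (2 * e i * Num.sqrt y)^-1)) = (Num.sqrt y)^-1.
    by field; rewrite !gt_eqF.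
  by rewrite exprVn invrK sqr_sqrtr// ltW.
have -> : e i * (c + (ln y + 1) / e i - c) - 1 = ln y by field; rewrite gt_eqF.
by rewrite lnK.
Qed.

Lemma kkt_coord_gap i (c l : R) : 0 < e i -> b i -> l <= c + cgrad (b i) (e i) 1 -> 0 < c - l.
Proof.
move=> ei bi; rewrite /cgrad bi sqrtr1 => lc.
have : 0 < (2 * e i * 1)^-1 by rewrite invr_gt0 !mulr_gt0.
lra.
Qed.

Lemma kkt_coord_gt0 i (c l : R) : 0 < e i -> l <= c + cgrad (b i) (e i) 1 -> 0 < kkt_coord i c l.
Proof.
move=> ei lc; rewrite /kkt_coord; case bi: (b i); last exact: expR_gt0.
by rewrite invr_gt0 exprn_gt0// !mulr_gt0// (kkt_coord_gap ei bi).
Qed.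

Lemma cgrad_kkt_coord i (c l : R) : 0 < e i -> l <= c + cgrad (b i) (e i) 1 ->
  c + cgrad (b i) (e i) (kkt_coord i c l) = l.
Proof.
move=> ei lc; rewrite /kkt_coord /cgrad; case bi: (b i).
  have g0 := kkt_coord_gap ei bi lc.
  rewrite -exprVn sqrtr_sqr gtr0_norm ?invr_gt0 ?mulr_gt0//.
  by field; rewrite !gt_eqF.
by rewrite expRK; field; rewrite gt_eqF.
Qed.

Lemma kkt_coord_le i (c l l' : R) : 0 < e i -> l <= l' -> l' <= c + cgrad (b i) (e i) 1 ->
  kkt_coord i c l <= kkt_coord i c l'.
Proof.
move=> ei ll' lc; rewrite /kkt_coord; case bi: (b i); last first.
  by rewrite ler_expR lerD2r ler_pM2l// lerD2r.
have g0 := kkt_coord_gap ei bi lc.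
have g1 := kkt_coord_gap ei bi (le_trans ll' lc).
rewrite lef_pV2 ?posrE ?exprn_gt0 ?mulr_gt0//.
rewrite lerXn2r ?nnegrE ?mulr_ge0 ?(ltW ei) ?(ltW g0) ?(ltW g1)//.
by rewrite ler_pM2l ?mulr_gt0//; lra.
Qed.

Lemma kkt_coord_continuous i (c l : R) : 0 < e i -> l <= c + cgrad (b i) (e i) 1 ->
  {for l, continuous (kkt_coord i c)}.
Proof.
move=> ei lc; rewrite /kkt_coord; case bi: (b i).
  have g0 := kkt_coord_gap ei bi lc.
  apply: cvgV; first by rewrite gt_eqF// exprn_gt0// !mulr_gt0.
  have gc : ((2 * e i * (c - x))%R @[x --> l] --> (2 * e i * (c - l))%R)%classic.
    by apply: cvgM; [exact: cvg_cst|apply: cvgB; [exact: cvg_cst|exact: cvg_id]].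
  exact: (cvgM gc gc).
apply: (@continuous_comp _ _ _ (fun l => e i * (l - c) - 1) expR); last exact: continuous_expR.
apply: cvgB; last exact: cvg_cst.
apply: cvgM; first exact: cvg_cst.
by apply: cvgB; [exact: cvg_id|exact: cvg_cst].
Qed.

Lemma exists_minimal (u : I -> R) : A != finset.set0 ->
  exists2 i, i \in A & forall j, j \in A -> u i <= u j.
Proof.
move=> /set0Pn[i0 i0A].
by have [i iA ui] := @Order.TotalTheory.arg_minP _ _ I i0 (mem A) u i0A; exists i.
Qed.

(* Intermediate value theorem for the multiplier: at the smallest value [l1] for
   which some coordinate reaches 1 the sum is at least 1, and for small values
   all the coordinates are below [1 / #|A|]. *)
Lemma exists_kkt (c : I -> R) : A != finset.set0 ->
  exists2 y, simplex_interior y &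
    exists l, forall i, i \in A -> c i + cgrad (b i) (e i) (y i) = l.
Proof.
move=> A0.
have N0 : 0 < #|A|%:R :> R by rewrite ltr0n card_gt0.
have N1 : 1 <= #|A|%:R :> R by rewrite ler1n card_gt0.
pose u i := c i + cgrad (b i) (e i) 1.
have [i1 i1A u1] := exists_minimal u A0.
pose v i := c i + cgrad (b i) (e i) (#|A|%:R^-1).
have [i0 i0A v0] := exists_minimal v A0.
(* At [v i0] every coordinate is at most [1 / #|A|]; the minimum with [u i1] keeps the interval
   nonempty. *)
pose l0 := Num.min (v i0) (u i1).
pose g l := \sum_(i in A) kkt_coord i (c i) l.
have lu i l : i \in A -> l <= u i1 -> l <= c i + cgrad (b i) (e i) 1.
  by move=> iA /le_trans; apply; exact: u1.
have gc : {within `[l0, u i1], continuous g}%classic.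
  apply: continuous_in_subspaceT => l; rewrite inE/= in_itv/= => /andP[_ ll].
  rewrite /g; apply: cvg_big => [|i iA]; first exact: add_continuous.
  by apply: kkt_coord_continuous; [exact: e_gt0|exact: lu].
have g1 : 1 <= g (u i1).
  rewrite /g (bigD1 i1)//= {1}/u kkt_coordK ?e_gt0// lerDl.
  apply: sumr_ge0 => i /andP[iA _]; apply/ltW/kkt_coord_gt0; first exact: e_gt0.
  exact: lu.
have g0 : g l0 <= 1.
  apply: (@le_trans _ _ (\sum_(i in A) #|A|%:R^-1)); last first.
    by rewrite sumr_const -[leLHS]mulr_natl divff ?gt_eqF.
  apply: ler_sum => i iA.
  rewrite -[leRHS](kkt_coordK (c i) (e_gt0 iA)); last by rewrite invr_gt0.
  apply: kkt_coord_le; first exact: e_gt0.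
    by rewrite ge_min -/(v i) v0.
  rewrite lerD2l /cgrad; case: ifP => _.
    rewrite lerN2 lef_pV2 ?posrE ?mulr_gt0 ?sqrtr_gt0 ?invr_gt0 ?e_gt0//.
    by rewrite ler_pM2l ?mulr_gt0 ?e_gt0// ler_sqrt// invf_le1.
  rewrite ler_pM2r ?invr_gt0 ?e_gt0// lerD2r ler_ln ?posrE ?invr_gt0//.
  by rewrite invf_le1.
have l01 : l0 <= u i1 by rewrite ge_min lexx orbT.
have [|l + gl] := IVT (v := 1) l01 gc.
  by rewrite ge_min g0/= le_max g1 orbT.
rewrite in_itv/= => /andP[_ ll].
have y0 i : i \in A -> 0 < kkt_coord i (c i) l.
  by move=> iA; apply: kkt_coord_gt0; [exact: e_gt0|exact: lu].
exists (fun i => if i \in A then kkt_coord i (c i) l else 0).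
  split; last by move=> i iA; rewrite iA; exact: y0.
  split.
  - by move=> i; case: ifP => // /y0/ltW.
  - by move=> i /negPf ->.
  - by rewrite -[RHS]gl; apply: eq_bigr => i ->.
exists l => i iA; rewrite iA; apply: cgrad_kkt_coord; [exact: e_gt0|exact: lu].
Qed.

(** Expanding [F] exactly at a point [y] with constant shifted gradient gives
    [F x = F y + sepbreg x y] on the whole simplex. This settles existence, uniqueness and
    interiority of the minimizer at once, and forces [xget] to return [y]. *)
Lemma argmin_kkt (c : I -> R) (K : R) (F : (I -> R) -> R) : A != finset.set0 ->
  (forall x, simplex A x -> F x = \sum_(i in A) c i * x i + seppot x + K) ->
  simplex_interior (argmin (simplex A) F) /\
  exists l, forall i, i \in A -> c i + cgrad (b i) (e i) (argmin (simplex A) F i) = l.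
Proof.
move=> A0 FE; have [y yint [l yl]] := exists_kkt c A0.
have [[y0 yA y1] yp] := yint.
have Fy x : simplex A x -> F x = F y + sepbreg x y.
  move=> [x0 xA x1]; rewrite !FE//.
  suff : \sum_(i in A) c i * x i + seppot x - (\sum_(i in A) c i * y i + seppot y)
      - sepbreg x y = 0 by lra.
  rewrite -!big_split/= -sumrB -sumrB.
  transitivity (\sum_(i in A) (l * x i - l * y i)).
    apply: eq_bigr => i iA; rewrite (cpot_taylor (b i) (e_gt0 iA) (x0 i) (yp i iA)).
    by rewrite -(yl i iA); ring.
  by rewrite sumrB -!mulr_sumr x1 y1 subrr.
suff -> : argmin (simplex A) F = y by split=> //; exists l.
apply: xget_unique => [|x [xS xmin]] /=.
  by split=> // x xS; rewrite (Fy x)// lerDl sepbreg_ge0.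
have [x0 xA x1] := xS.
have : sepbreg x y = 0.
  apply/eqP; rewrite eq_le sepbreg_ge0// andbT.
  have [ys _] := yint; have := xmin _ ys; rewrite (Fy x)//; lra.
move/eqP; rewrite psumr_eq0; last first.
  by move=> i iA; apply: cbreg_ge0; [exact: e_gt0|exact: x0|exact: yp].
move=> /allP h; apply/funext => i.
have [iA|iA] := boolP (i \in A); last by rewrite xA// yA.
have := h i (mem_index_enum _); rewrite iA/= => /eqP.
by apply: cbreg_eq0; [exact: e_gt0|exact: x0|exact: yp].
Qed.

Lemma argmin_seppot : A != finset.set0 ->
  simplex_interior (argmin (simplex A) seppot) /\
  exists l, forall i, i \in A -> cgrad (b i) (e i) (argmin (simplex A) seppot i) = l.
Proof.
move=> A0; have [|? [l hl]] := @argmin_kkt (fun=> 0) 0 seppot A0.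
  by move=> x _; rewrite big1 ?add0r ?addr0// => i _; rewrite mul0r.
by split=> //; exists l => i iA; rewrite -(hl i iA) add0r.
Qed.

(** The factor [w] serves the local level, where the learning rate multiplies the losses; at the
    global level the rates sit inside [Psi] and [w] is 1. *)
Lemma argmin_mirror_step (w : R) (L : I -> R) y : A != finset.set0 -> simplex_interior y ->
  let y' := argmin (simplex A) (fun x => w * inner x L + bregman seppot x y) in
  simplex_interior y' /\
  exists l, forall i, i \in A ->
    w * L i - cgrad (b i) (e i) (y i) + cgrad (b i) (e i) (y' i) = l.
Proof.
move=> A0 yint; have [[y0 yA y1] yp] := yint.
apply: (@argmin_kkt _ (\sum_(i in A) cgrad (b i) (e i) (y i) * y i - seppot y)) => // x xS.
have [x0 xA x1] := xS; rewrite bregman_seppot//.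
rewrite /inner (bigID (mem A))/= [X in _ * (_ + X)]big1 ?addr0; last first.
  by move=> i iA; rewrite xA// mul0r.
rewrite mulr_sumr -!addrA -sumrB -!big_split/=; apply: eq_bigr => i iA.
rewrite (cpot_taylor (b i) (e_gt0 iA) (x0 i) (yp i iA)); ring.
Qed.

(** The three-point identity of Bregman divergences. The multiplier [l] cancels because [x] and [y']
    have equal mass, and [s] can be inserted because [y] and [y'] do; its choice is thus left to the
    analysis. *)
Lemma mirror_descent_identity (L : I -> R) (s l : R) x y y' :
    simplex A x -> simplex_interior y -> simplex_interior y' ->
    (forall i, i \in A -> L i - cgrad (b i) (e i) (y i) + cgrad (b i) (e i) (y' i) = l) ->
  \sum_(i in A) L i * (y i - x i) = sepbreg x y - sepbreg x y' +
    \sum_(i in A) ((L i - s) * (y i - y' i) - cbreg (b i) (e i) (y' i) (y i)).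
Proof.
move=> [x0 xA x1] [[y0 yA y1] yp] [[y'0 y'A y'1] y'p] hl.
apply/eqP; rewrite -subr_eq0 /sepbreg -sumrB -big_split/= -sumrB.
rewrite (eq_bigr (fun i => (l * y' i - l * x i) + (s * y i - s * y' i))).
  by rewrite big_split/= !sumrB -!mulr_sumr x1 y1 y'1 !subrr addr0.
move=> i iA; have e0 := e_gt0 iA.
have h1 := cpot_taylor (b i) e0 (x0 i) (yp i iA).
have h2 := cpot_taylor (b i) e0 (x0 i) (y'p i iA).
have h3 := cpot_taylor (b i) e0 (y'0 i) (yp i iA).
have := hl i iA.
move: h1 h2 h3; set g := cgrad _ _ _; set g' := cgrad _ _ _.
set px := cpot _ _ _; set py := cpot _ _ _; set py' := cpot _ _ _.
set d1 := cbreg _ _ _ _; set d2 := cbreg _ _ _ _; set d3 := cbreg _ _ _ _.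
move=> h1 h2 h3 <-.
have -> : d1 = px - py - g * (x i - y i) by rewrite h1; ring.
have -> : d2 = px - py' - g' * (x i - y' i) by rewrite h2; ring.
have -> : d3 = py' - py - g * (y' i - y i) by rewrite h3; ring.
ring.
Qed.

(** At the starting point the gradient is constant, so its linear term vanishes on differences of
    points of the simplex. *)
Lemma sepbreg_argmin x y : simplex A x -> simplex_interior y ->
    (exists l, forall i, i \in A -> cgrad (b i) (e i) (y i) = l) ->
  sepbreg x y = seppot x - seppot y.
Proof.
move=> [x0 xA x1] [[y0 yA y1] yp] [l hl].
transitivity (\sum_(i in A) ((cpot (b i) (e i) (x i) - cpot (b i) (e i) (y i))
    - (l * x i - l * y i))).
  apply: eq_bigr => i iA; rewrite (cpot_taylor (b i) (e_gt0 iA) (x0 i) (yp i iA)).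
  by rewrite hl//; ring.
by rewrite !sumrB -!mulr_sumr x1 y1 subrr subr0.
Qed.

End SeparablePotential.

(** * Cauchy-Schwarz, entropy, and sums over histories *)

Section FiniteSums.
Context {R : realType} {I : finType}.
Implicit Types (A : {set I}) (w y : I -> R).

Lemma sum_mul_sqrt_le A w y : (forall i, 0 <= y i) -> \sum_(i in A) y i <= 1 ->
  \sum_(i in A) w i * Num.sqrt (y i) <= Num.sqrt (\sum_(i in A) w i ^+ 2).
Proof.
move=> y0 y1; set W := \sum_(i in A) w i ^+ 2.
have W0 : 0 <= W by apply: sumr_ge0 => i _; exact: sqr_ge0.
have [Wz|Wn] := eqVneq W 0.
  rewrite big1 ?sqrtr_ge0// => i iA.
  have := psumr_eq0P (fun i _ => sqr_ge0 (w i)) Wz iA.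
  by move/eqP; rewrite sqrf_eq0 => /eqP ->; rewrite mul0r.
have c0 : 0 < Num.sqrt W by rewrite sqrtr_gt0 lt_neqAle eq_sym Wn.
set c := Num.sqrt W in c0 *.
(* Young's inequality with parameter [c = sqrt W], for which each of the two halves sums to at most
   [c / 2]. *)
apply: (@le_trans _ _ (\sum_(i in A) (w i ^+ 2 / c / 2 + c / 2 * y i))).
  apply: ler_sum => i iA; rewrite -[in leRHS](sqr_sqrtr (y0 i)) -subr_ge0.
  have -> : w i ^+ 2 / c / 2 + c / 2 * Num.sqrt (y i) ^+ 2 - w i * Num.sqrt (y i)
          = (w i - c * Num.sqrt (y i)) ^+ 2 / (2 * c) by field; rewrite gt_eqF.
  by rewrite divr_ge0 ?sqr_ge0// mulr_ge0// ltW.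
rewrite big_split/= -!mulr_suml -mulr_sumr -/W -{1}(sqr_sqrtr W0) -/c.
have -> : c ^+ 2 / c / 2 = c / 2 by field; rewrite gt_eqF.
by nra.
Qed.

Lemma sum_sqrt_le A y : (forall i, 0 <= y i) -> \sum_(i in A) y i <= 1 ->
  \sum_(i in A) Num.sqrt (y i) <= Num.sqrt #|A|%:R.
Proof.
move=> y0 y1; have := @sum_mul_sqrt_le A (fun=> 1) y y0 y1.
rewrite (eq_bigr (fun i => Num.sqrt (y i))); last by move=> i _; rewrite mul1r.
by under [X in Num.sqrt X]eq_bigr do rewrite expr1n; rewrite sumr_const.
Qed.

(** The sum of the inequalities [- y * ln (M * y) <= 1 / M - y]. The total mass is kept free because
    some coordinates of a distribution may have mass below 1. *)
Lemma entropy_le A y (M : R) : 0 < M -> (forall i, 0 <= y i) ->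
  - \sum_(i in A) y i * ln (y i)
    <= (\sum_(i in A) y i) * ln M + #|A|%:R / M - \sum_(i in A) y i.
Proof.
move=> M0 y0.
have -> : #|A|%:R / M = \sum_(i in A) M^-1 by rewrite sumr_const -[RHS]mulr_natl.
rewrite mulr_suml -sumrN -big_split/= -sumrB; apply: ler_sum => i _.
have := y0 i; rewrite le_eqVlt => /predU1P[<-|yi].
  have : 0 <= M^-1 by rewrite invr_ge0 ltW.
  by rewrite !mul0r; lra.
have := expR_ge1Dx (- (ln M + ln (y i))).
rewrite expRN expRD !lnK ?posrE// => h.
have e1 : y i * (M * y i)^-1 = M^-1 by field; rewrite !gt_eqF.
have : y i * (1 + - (ln M + ln (y i))) <= y i * (M * y i)^-1 by rewrite ler_pM2l.
by rewrite e1; lra.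
Qed.

Lemma rcons_tuple_bij (n : nat) :
  bijective (fun wa : n.-tuple I * I => [tuple of rcons wa.1 wa.2]).
Proof.
apply: inj_card_bij => [[w a] [w' a']|]/=.
  by move/(congr1 val)/rcons_inj => [/val_inj -> ->].
by rewrite card_prod !card_tuple expnSr.
Qed.

Lemma sum_tuple_rcons (W : nmodType) (n : nat) (F : n.+1.-tuple I -> W) :
  \sum_w F w = \sum_(w : n.-tuple I) \sum_a F [tuple of rcons w a].
Proof.
rewrite pair_bigA/= (reindex (fun wa : n.-tuple I * I => [tuple of rcons wa.1 wa.2]))//=.
exact/onW_bij/rcons_tuple_bij.
Qed.

End FiniteSums.

(** * Law of the plays and the drift argument *)

Section Drift.
Context {R : realType} {V : finType} {m : nat}.
Variables (E : rel V) (s : nat) (blk : V -> 'I_m) (p : params R V m).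
Variable ell : nat -> V -> R.

Lemma path_law_rcons (T : nat) (w : T.-tuple V) (a : V) :
  path_law E s blk p ell [tuple of rcons w a]
  = path_law E s blk p ell w * Z s blk p T (state_after E s blk p ell (rev w)) a.
Proof.
rewrite /path_law big_ord_recr/=; congr (_ * _).
  apply: eq_bigr => i _ /=.
  rewrite (tnth_nth a) (tnth_nth a w)/= nth_rcons size_tuple ltn_ord.
  by rewrite -cats1 takel_cat// size_tuple ltnW.
rewrite (tnth_nth a)/= nth_rcons size_tuple ltnn eqxx.
by rewrite -cats1 takel_cat ?size_tuple// take_oversize// size_tuple.
Qed.

(** A Foster-Lyapunov argument by induction on the number of rounds. The induction also carries that
    the path law is nonnegative with mass 1, so that the bound at each state can be averaged; the
    invariant is kept along every history. The final potential is dropped by nonnegativity. *)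
Lemma drift_bound (inv : @state R V m -> Prop) (pot : @state R V m -> R)
    (C : nat -> R) (T : nat) :
    inv (init_state E s blk p) ->
    (forall t st, (t < T)%N -> inv st ->
      [/\ forall a, 0 <= Z s blk p t st a,
          \sum_a Z s blk p t st a = 1,
          forall a, inv (next_state E s blk p t st (ell t) a) &
          \sum_a Z s blk p t st a *
             (ell t a + pot (next_state E s blk p t st (ell t) a)) <= C t + pot st]) ->
    (forall st, inv st -> 0 <= pot st) ->
  \sum_(w : T.-tuple V) path_law E s blk p ell w * (\sum_(t < T) ell t (tnth w t))
    <= pot (init_state E s blk p) + \sum_(t < T) C t.
Proof.
move=> inv0 step pot0.
suff H n : (n <= T)%N ->
   [/\ forall w : n.-tuple V, 0 <= path_law E s blk p ell w
        /\ inv (state_after E s blk p ell (rev w)),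
      \sum_(w : n.-tuple V) path_law E s blk p ell w = 1 &
   \sum_(w : n.-tuple V) path_law E s blk p ell w *
     (\sum_(t < n) ell t (tnth w t) + pot (state_after E s blk p ell (rev w)))
   <= pot (init_state E s blk p) + \sum_(t < n) C t].
  have [Hw _] := H T (leqnn T); apply: le_trans; apply: ler_sum => w _.
  by have [w0 /pot0 iw] := Hw w; rewrite ler_wpM2l// lerDl.
elim: n => [_|n IH nT].
  have w0 (w : 0.-tuple V) : w = [tuple] by rewrite tuple0.
  have sum0 (F : 0.-tuple V -> R) : \sum_w F w = F [tuple].
    by rewrite (big_pred1 [tuple])// => w; rewrite (w0 w)/= eqxx.
  split=> [w||]; first by rewrite (w0 w) /path_law big_ord0.
    by rewrite sum0 /path_law big_ord0.
  by rewrite sum0 /path_law !big_ord0/= mul1r add0r addr0.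
have [Hw Hone Hsum] := IH (ltnW nT); split.
- have [g _ gK] := @rcons_tuple_bij V n.
  move=> w; rewrite -(gK w); case: (g w) => w' a /=.
  have [w0 iw] := Hw w'; have [z0 _ zn _] := step n _ nT iw.
  rewrite path_law_rcons mulr_ge0//; split=> //.
  by rewrite /= rev_rcons/= size_rev size_tuple; exact: zn.
- rewrite sum_tuple_rcons -[RHS]Hone; apply: eq_bigr => w _.
  have [w0 iw] := Hw w; have [_ z1 _ _] := step n _ nT iw.
  by under eq_bigr do rewrite path_law_rcons; rewrite -mulr_sumr z1 mulr1.
rewrite sum_tuple_rcons.
apply: (@le_trans _ _ (\sum_(w : n.-tuple V) path_law E s blk p ell w *
     (\sum_(t < n) ell t (tnth w t) + (C n + pot (state_after E s blk p ell (rev w)))))).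
  apply: ler_sum => w _; have [w0 iw] := Hw w; have [z0 z1 _ zs] := step n _ nT iw.
  under eq_bigr do rewrite path_law_rcons -mulrA.
  rewrite -mulr_sumr; apply: ler_wpM2l => //.
  rewrite -[X in _ <= X + _]mul1r -z1 mulr_suml.
  apply: le_trans (lerD (lexx _) zs); rewrite -big_split/=; apply: ler_sum => a _.
  rewrite -mulrDr ler_wpM2l// big_ord_recr/= -addrA lerD//.
    apply: ler_sum => i _; rewrite (tnth_nth a) (tnth_nth a w)/=.
    by rewrite nth_rcons size_tuple ltn_ord.
  rewrite (tnth_nth a)/= nth_rcons size_tuple ltnn eqxx.
  by rewrite rev_rcons/= size_rev size_tuple.
under eq_bigr do rewrite addrCA mulrDr.
by rewrite big_split/= -mulr_suml Hone mul1r addrC big_ord_recr/= addrA lerD2r.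
Qed.

End Drift.

(** * The linear program of a block *)

Section LinearProgram.
Context {R : realType} {V : finType} {m : nat}.
Variables (E : rel V) (blk : V -> 'I_m) (k : 'I_m).
Hypothesis obs : observable_on E (block blk k).

(** [delta_star] is an infimum, whereas the exploration factors need an optimal vector. The feasible
    part of the cube [[0, 1]^V] is compact by Tychonoff's theorem, and the objective is continuous
    on it. *)
Lemma delta_star_attained :
  exists x : V -> R,
    [/\ forall v, 0 <= x v <= 1,
        forall u, u \in block blk k -> 1 <= \sum_(v in Nin E u :&: block blk k) x v
      & \sum_(v in block blk k) x v = delta_star E blk R k].
Proof.
pose T := prod_topology (fun _ : V => R : topologicalType).
pose K : set T := [set x | forall v, `[0 : R, 1]%classic (x v)]%classic.
pose D : set T := (\bigcap_(u in [set u | u \in block blk k])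
  [set x : T | 1%R <= \sum_(v in Nin E u :&: block blk k) (x v : R)])%classic.
have sumc (W : {set V}) : continuous (fun x : T => \sum_(v in W) (x v : R)).
  move=> x.
  refine (@cvg_big R V +%R 0 (fun v => v \in W) _ T (nbhs x) (index_enum V)
    (fun v (y : T) => y v) (fun v => x v) _ _); first exact: add_continuous.
  move=> v _; exact: (@proj_continuous V (fun=> R : topologicalType) v x).
have KD : compact (K `&` D)%classic.
  apply: compact_closedI.
    exact: (@tychonoff V (fun=> R : topologicalType) (fun=> `[0 : R, 1]%classic)
      (fun=> @segment_compact R 0 1)).
  apply: closed_bigI => u _.
  have -> : [set x : T | 1%R <= \sum_(v in Nin E u :&: block blk k) (x v : R)]%classic
    = ((fun x : T => \sum_(v in Nin E u :&: block blk k) (x v : R)) @^-1`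
         [set y : R | 1%R <= y])%classic by [].
  by apply: preimage_closed; [move=> x _; exact: sumc|exact: closed_ge].
have [||x] := compact_EVT_min (f := fun x : T => \sum_(v in block blk k) (x v : R)) _ KD.
- exists (fun=> 1); split=> [v|u/= ub]; first by rewrite /= in_itv/= ler01 lexx.
  rewrite sumr_const ler1n card_gt0; exact: obs.
- exact/continuous_subspaceT/sumc.
rewrite inE => -[xK xD] xmin; exists x; split.
- by move=> v; have := xK v; rewrite /= in_itv.
- by move=> u ub; exact: (xD u).
apply/esym/eqP; rewrite eq_le; apply/andP; split.
  apply: ge_inf.
    exists 0 => _ [y [_ y01] <-]; apply: sumr_ge0 => v vb.
    by have /andP[] := y01 v vb.
  exists x => //; split=> [u ub|v _]; first exact: (xD u).
  by have := xK v; rewrite /= in_itv.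
apply: lb_le_inf.
  exists (\sum_(v in block blk k) x v); exists x => //; split=> [u ub|v _].
    exact: (xD u).
  by have := xK v; rewrite /= in_itv.
move=> _ [y [yD y01] <-].
(* A competitor is bounded on the block only. Truncation puts it into the cube and changes neither
   its objective nor its constraints. *)
pose y' : T := fun v => if v \in block blk k then y v else 0.
have -> : \sum_(v in block blk k) y v = \sum_(v in block blk k) (y' v : R).
  by apply: eq_bigr => v vb; rewrite /y' vb.
apply: xmin; rewrite inE; split=> [v|u ub] /=.
  rewrite /y' in_itv/=; case: ifP => [vb|_]; first exact: y01.
  by rewrite lexx ler01.
rewrite (eq_bigr y); first exact: yD.
by move=> v; rewrite inE /y' => /andP[_ ->].
Qed.

(** The constraint at a single vertex of the block already forces mass 1. *)
Lemma delta_star_ge1 : block blk k != finset.set0 -> 1 <= delta_star E blk R k.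
Proof.
have [x [x01 xD <-]] := delta_star_attained.
move=> /set0Pn[u ub]; apply: le_trans (xD u ub) _.
rewrite [leRHS](bigID (mem (Nin E u)))/=.
rewrite (eq_bigl (fun v => (v \in block blk k) && (v \in Nin E u))); last first.
  by move=> v; rewrite inE andbC.
rewrite lerDl; apply: sumr_ge0 => v _; by case/andP: (x01 v).
Qed.

End LinearProgram.

(** * One round of the algorithm *)

Section Structure.
Context {R : realType} {V : finType} {m : nat}.
Variables (E : rel V) (s : nat) (blk : V -> 'I_m).
Hypothesis legal : legal_partition E s blk.

Lemma in_U1NS k :
  (k \in U1NS E s blk) = (k \notin @U2 m s) && (k \notin U1S E s blk).
Proof. by rewrite inE andbC [in LHS]inE [k \in U2 s]inE -ltnNge. Qed.

Lemma U1S_notin_U2 k : k \in U1S E s blk -> k \notin @U2 m s.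
Proof. by rewrite inE => /andP[+ _]; rewrite !inE -ltnNge. Qed.

Lemma notin_U2 k : (k \notin @U2 m s) = (k \in @U1 m s).
Proof. by rewrite !inE -ltnNge. Qed.

Lemma sum_split3 (F : 'I_m -> R) : \sum_k F k =
  \sum_(k in @U2 m s) F k + \sum_(k in U1S E s blk) F k + \sum_(k in U1NS E s blk) F k.
Proof.
rewrite (bigID (mem (@U2 m s)))/= -addrA; congr (_ + _).
rewrite (bigID (mem (U1S E s blk)))/=; congr (_ + _); apply: eq_bigl => k.
  by case: (boolP (k \in U1S E s blk)) => [/U1S_notin_U2 ->|]//; rewrite andbF.
by rewrite in_U1NS.
Qed.

Lemma block_blk v : v \in block blk (blk v). Proof. by rewrite inE. Qed.

Lemma mem_block v k : (v \in block blk k) = (blk v == k). Proof. by rewrite inE. Qed.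

Lemma block_singleton k : k \notin @U2 m s -> exists v, block blk k = [set v]%SET.
Proof.
by case: legal => _ _ _ h _; rewrite notin_U2 => /h[/eqP/cards1P[v ->] _]; exists v.
Qed.

Lemma U1S_loop k v : k \in U1S E s blk -> v \in block blk k -> E v v.
Proof.
move=> kS; have [w bk] := block_singleton (U1S_notin_U2 kS).
move: kS; rewrite inE => /andP[_ /exists_inP[w']].
by rewrite bk !inE => /eqP -> ww /eqP ->.
Qed.

Lemma U1NS_Nin k v : k \in U1NS E s blk -> v \in block blk k -> Nin E v = [set~ v]%SET.
Proof.
rewrite in_U1NS => /andP[kU2 kS] vb; case: legal => _ _ _ h _.
have kU1 : k \in @U1 m s by rewrite -notin_U2.
have [_ /(_ v vb) [vv|//]] := h k kU1.
by case/negP: kS; rewrite inE kU1/=; apply/exists_inP; exists v.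
Qed.

Lemma U1NS_inj v w : blk v \in U1NS E s blk -> blk w = blk v -> w = v.
Proof.
rewrite in_U1NS => /andP[/block_singleton[u bu] _] bw.
have := block_blk v; have := block_blk w; rewrite bw bu !inE.
by move=> /eqP -> /eqP.
Qed.

Lemma sum_blocks (F : V -> R) : \sum_v F v = \sum_k \sum_(v in block blk k) F v.
Proof.
rewrite (partition_big blk xpredT)//=; apply: eq_bigr => k _.
by apply: eq_bigl => v; rewrite mem_block.
Qed.

Variable p : params R V m.

(** [Psi] mixes two shapes and three rates; [coord_kind] and [coord_rate] present it as one
    separable potential over ['I_m], with [true] for the square root. *)
Definition coord_kind (k : 'I_m) : bool := k \notin U1NS E s blk.

Definition coord_rate (k : 'I_m) : R :=
  if k \in @U2 m s then eta p else if k \in U1S E s blk then eta_S p else eta_NS p.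

Lemma coord_rate_U2 k : k \in @U2 m s -> coord_rate k = eta p.
Proof. by rewrite /coord_rate => ->. Qed.

Lemma coord_rate_U1S k : k \in U1S E s blk -> coord_rate k = eta_S p.
Proof. by move=> kS; rewrite /coord_rate (negPf (U1S_notin_U2 kS)) kS. Qed.

Lemma coord_rate_U1NS k : k \in U1NS E s blk -> coord_rate k = eta_NS p.
Proof. by rewrite in_U1NS /coord_rate => /andP[/negPf -> /negPf ->]. Qed.

Lemma coord_kind_U2 k : k \in @U2 m s -> coord_kind k.
Proof. by rewrite /coord_kind in_U1NS => ->. Qed.

Lemma coord_kind_U1S k : k \in U1S E s blk -> coord_kind k.
Proof. by rewrite /coord_kind in_U1NS => ->; rewrite andbF. Qed.

Lemma coord_kind_U1NS k : k \in U1NS E s blk -> coord_kind k = false.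
Proof. by rewrite /coord_kind => ->. Qed.

Lemma PsiE : Psi E s blk p = seppot [set: 'I_m] coord_kind coord_rate.
Proof.
apply/funext => y; rewrite /Psi /seppot.
under [RHS]eq_bigl do rewrite finset.in_setT.
rewrite sum_split3; congr (_ + _ + _); apply: eq_bigr => k kU; rewrite /cpot.
- by rewrite coord_kind_U2// coord_rate_U2.
- by rewrite coord_kind_U1S// coord_rate_U1S.
- by rewrite coord_kind_U1NS// coord_rate_U1NS.
Qed.

Lemma PhiE k : Phi blk k = seppot (block blk k) (fun=> false) (fun=> 1 : R).
Proof. by apply/funext => x; apply: eq_bigr => v _; rewrite /cpot divr1. Qed.

End Structure.

Section Round.
Context {R : realType} {V : finType} {m : nat}.
Variables (E : rel V) (s : nat) (blk : V -> 'I_m).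
Hypothesis legal : legal_partition E s blk.
Variable p : params R V m.
Hypothesis eta_pos : [/\ 0 < eta p, 0 < eta_S p & 0 < eta_NS p].
Hypothesis eta_loc_pos : forall k, k \in @U2 m s -> 0 < eta_loc p k.

Local Notation U2 := (@U2 m s).
Local Notation U1S := (U1S E s blk).
Local Notation U1NS := (U1NS E s blk).
Local Notation block := (block blk).
Local Notation kind := (coord_kind E s blk).
Local Notation rate := (coord_rate E s blk p).

Lemma coord_rate_gt0 k : 0 < rate k.
Proof. by have [? ? ?] := eta_pos; rewrite /coord_rate; case: ifP => // _; case: ifP. Qed.

Lemma block_neq0 k : block k != finset.set0.
Proof. by case: legal. Qed.

Lemma ord_set_neq0 (v : V) : [set: 'I_m]%SET != finset.set0.
Proof. by apply/set0Pn; exists (blk v). Qed.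

Definition good (st : @state R V m) : Prop :=
  simplex_interior [set: 'I_m]%SET (dist_Y st) /\
  forall k, k \in U2 -> simplex_interior (block k) (dist_X st k).

Lemma init_good (v : V) : good (init_state E s blk p).
Proof.
split=> [|k kU] /=.
  by rewrite PsiE; case: (argmin_seppot kind (fun k _ => coord_rate_gt0 k) (ord_set_neq0 v)).
rewrite kU PhiE.
by case: (argmin_seppot (e := fun=> 1 : R) (fun=> false) (fun _ _ => ltr01) (block_neq0 k)).
Qed.

Section FixedRound.
Variables (t : nat) (st : @state R V m) (ell : V -> R).
Hypothesis st_good : good st.
Hypothesis ell01 : forall v, 0 <= ell v <= 1.
Hypothesis gam_ge0 : forall v, 0 <= gam p t v.
Hypothesis gam_lt1 : \sum_v gam p t v < 1.
Hypothesis gam_loc_ge0 : forall k, k \in U2 ->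
  (forall v, v \in block k -> 0 <= gam_loc p t v) /\
  \sum_(v in block k) gam_loc p t v < 1.

Local Notation Y := (dist_Y st).
Local Notation X := (dist_X st).
Local Notation z := (Z s blk p t st).
Local Notation gbar := (\sum_v gam p t v).
Local Notation lhat := (ellhat E s blk p t st ell).
Local Notation Lh := (Lhat E s blk p t st ell).
Local Notation next := (next_state E s blk p t st ell).

Definition prob_observed v : R := \sum_(u in Nin E v) z u.
Local Notation P := prob_observed.

(** The value 1 on singleton blocks gives [Z] and [Lhat] one formula for [U1] and [U2]. *)
Definition block_dist k v : R := if k \in U2 then Xtilde blk p t st k v else 1.
Local Notation q := block_dist.

Lemma Y_gt0 k : 0 < Y k.
Proof. by case: st_good => -[_ h] _; apply: h. Qed.

Lemma sum_Y : \sum_k Y k = 1.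
Proof.
case: st_good => -[[_ _ h] _] _; rewrite -[RHS]h.
by apply: eq_bigl => k; rewrite finset.in_setT.
Qed.

Lemma sum_Y_le1 (A : {set 'I_m}) : \sum_(k in A) Y k <= 1.
Proof.
rewrite -sum_Y [leRHS](bigID (mem A))/= lerDl; apply: sumr_ge0 => k _.
exact/ltW/Y_gt0.
Qed.

Lemma Y_le1 k : Y k <= 1.
Proof. by have := sum_Y_le1 [set k]; rewrite big_set1. Qed.

Lemma gbar_ge0 : 0 <= gbar. Proof. exact: sumr_ge0. Qed.

Lemma block_dist_gt0 k v : v \in block k -> 0 < q k v.
Proof.
move=> vb; rewrite /block_dist; case: ifP => // kU; have [g0 g1] := gam_loc_ge0 kU.
rewrite ltr_wpDr ?g0// mulr_gt0 ?subr_gt0//.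
by case: st_good => _ /(_ _ kU)[_]; apply.
Qed.

Lemma sum_block_dist k : \sum_(v in block k) q k v = 1.
Proof.
rewrite /block_dist; case kU: (k \in U2).
  rewrite big_split/= -mulr_sumr; case: st_good => _ /(_ _ kU)[[_ _ ->] _].
  by rewrite mulr1 subrK.
have [v ->] := block_singleton legal (negbT kU).
by rewrite big_set1.
Qed.

Lemma ZE v : z v = (1 - gbar) * Y (blk v) * q (blk v) v + gam p t v.
Proof. by rewrite /Z /block_dist; case: ifP => // _; rewrite mulr1. Qed.

Lemma LhatE a k : Lh a k = \sum_(v in block k) q k v * lhat a v.
Proof.
rewrite /Lhat /block_dist; case: ifP => // _.
by apply: eq_bigr => v _; rewrite mul1r.
Qed.

Lemma Z_ge_blk k v : v \in block k -> (1 - gbar) * Y k * q k v <= z v.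
Proof. by rewrite mem_block ZE => /eqP ->; rewrite lerDl. Qed.

Lemma Z_ge_gam v : gam p t v <= z v.
Proof.
rewrite ZE lerDr !mulr_ge0 ?subr_ge0 ?(ltW gam_lt1)//; first exact/ltW/Y_gt0.
exact/ltW/block_dist_gt0/block_blk.
Qed.

Lemma Z_gt0 v : 0 < z v.
Proof.
rewrite ZE ltr_wpDr// !mulr_gt0 ?subr_gt0 ?Y_gt0//.
exact/block_dist_gt0/block_blk.
Qed.

Lemma sum_Z : \sum_v z v = 1.
Proof.
under eq_bigr do rewrite ZE.
rewrite big_split/= (sum_blocks blk).
rewrite (eq_bigr (fun k => (1 - gbar) * Y k)); last first.
  move=> k _; rewrite -[RHS]mulr1 -(sum_block_dist k) mulr_sumr.
  by apply: eq_bigr => v; rewrite mem_block => /eqP ->.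
by rewrite -mulr_sumr sum_Y mulr1 subrK.
Qed.

Lemma mass_block k : (1 - gbar) * Y k <= \sum_(v in block k) z v.
Proof.
rewrite -[leLHS]mulr1 -[X in _ * X <= _](sum_block_dist k) mulr_sumr.
by apply: ler_sum => v; exact: Z_ge_blk.
Qed.

Lemma prob_observed_gt0 v : 0 < P v.
Proof.
case: legal => obs _ _ _ _; have /set0Pn[u] := obs v (finset.in_setT v).
rewrite finset.setIT => uv; rewrite /P (bigD1 u)//= ltr_pwDl ?Z_gt0//.
by apply: sumr_ge0 => w _; exact/ltW/Z_gt0.
Qed.

Lemma lhat_ge0 a v : 0 <= lhat a v.
Proof.
rewrite /ellhat mulr_ge0 ?divr_ge0//; first exact/ltW/prob_observed_gt0.
by case/andP: (ell01 v).
Qed.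

Lemma lhat_le a v : lhat a v <= (P v)^-1.
Proof.
have [l0 l1] := andP (ell01 v); have P0 := prob_observed_gt0 v.
rewrite /ellhat -[leRHS]mulr1 ler_pM ?divr_ge0 ?(ltW P0)//.
by rewrite -[leRHS]mul1r ler_pM2r ?invr_gt0// lern1 leq_b1.
Qed.

Lemma expectation_lhat v : \sum_a z a * lhat a v = ell v.
Proof.
have P0 := prob_observed_gt0 v.
transitivity (\sum_(a in Nin E v) z a * (ell v / P v)).
  rewrite [RHS]big_mkcond; apply: eq_bigr => a _; rewrite /ellhat !inE -/(P v).
  by case: (E a v) => /=; rewrite ?mul1r ?mul0r ?mulr0// [_^-1 * _]mulrC.
by rewrite -mulr_suml -/(P v); field; rewrite gt_eqF.
Qed.

Lemma expectation_lhat_sqr v : \sum_a z a * lhat a v ^+ 2 <= (P v)^-1.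
Proof.
have P0 := prob_observed_gt0 v; have [l0 l1] := andP (ell01 v).
apply: (@le_trans _ _ (\sum_(a in Nin E v) z a * ((P v)^-1 ^+ 2))).
  rewrite [leRHS]big_mkcond; apply: ler_sum => a _; rewrite /ellhat !inE -/(P v).
  case: (E a v) => /=; last by rewrite !mul0r expr0n/= mulr0.
  rewrite ler_wpM2l ?(ltW (Z_gt0 a))// mul1r exprMn ler_piMr ?sqr_ge0//.
  by rewrite expr_le1.
rewrite -mulr_suml -/(P v) le_eqVlt; apply/orP; left; apply/eqP; field.
by rewrite gt_eqF.
Qed.

Lemma Lh_ge0 a k : 0 <= Lh a k.
Proof.
rewrite LhatE; apply: sumr_ge0 => v vb.
by rewrite mulr_ge0 ?lhat_ge0// ltW// block_dist_gt0.
Qed.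

Lemma expectation_Lh k :
  \sum_a z a * Lh a k = \sum_(v in block k) q k v * ell v.
Proof.
under eq_bigr do rewrite LhatE mulr_sumr.
rewrite exchange_big/=; apply: eq_bigr => v _.
rewrite -(expectation_lhat v) mulr_sumr; apply: eq_bigr => a _; ring.
Qed.

(** Jensen's inequality for the distribution [q k] reduces the square of the mixture to the second
    moments of the vertices, each at most [1 / P v]. *)
Lemma expectation_Lh_sqr k (B : R) : (forall v, v \in block k -> (P v)^-1 <= B) ->
  \sum_a z a * Lh a k ^+ 2 <= B.
Proof.
move=> PB.
have jensen a : Lh a k ^+ 2 <= \sum_(v in block k) q k v * lhat a v ^+ 2.
  have : 0 <= \sum_(v in block k) q k v * (lhat a v - Lh a k) ^+ 2.
    by apply: sumr_ge0 => v vb; rewrite mulr_ge0 ?sqr_ge0// ltW// block_dist_gt0.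
  rewrite (eq_bigr (fun v => q k v * lhat a v ^+ 2 - 2 * Lh a k * (q k v * lhat a v)
    + q k v * Lh a k ^+ 2)); last by move=> v _; ring.
  rewrite big_split/= sumrB -mulr_sumr -mulr_suml sum_block_dist -LhatE; lra.
apply: (@le_trans _ _ (\sum_a z a * \sum_(v in block k) q k v * lhat a v ^+ 2)).
  by apply: ler_sum => a _; rewrite ler_wpM2l// ltW// Z_gt0.
under eq_bigr do rewrite mulr_sumr.
rewrite exchange_big/= -[leRHS]mul1r -(sum_block_dist k) mulr_suml.
apply: ler_sum => v vb.
rewrite (eq_bigr (fun a => q k v * (z a * lhat a v ^+ 2))); last by move=> a _; ring.
rewrite -mulr_sumr ler_wpM2l ?(ltW (block_dist_gt0 vb))//.
exact: le_trans (expectation_lhat_sqr v) (PB v vb).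
Qed.

Lemma next_Y a :
  simplex_interior [set: 'I_m]%SET (dist_Y (next a)) /\
  exists l, forall k, k \in [set: 'I_m]%SET ->
    Lhat' E s blk p t st ell a k - cgrad (kind k) (rate k) (Y k)
      + cgrad (kind k) (rate k) (dist_Y (next a) k) = l.
Proof.
have Yint : simplex_interior [set: 'I_m]%SET Y by case: st_good.
have := argmin_mirror_step kind (fun k _ => coord_rate_gt0 k) 1
  (Lhat' E s blk p t st ell a) (ord_set_neq0 a) Yint.
rewrite /= PsiE.
under [X in argmin _ X]eq_fun do rewrite mul1r.
move=> [h [l hl]]; split=> //; exists l => k kT.
by rewrite -(hl k kT) mul1r.
Qed.

Lemma next_X a k : k \in U2 ->
  simplex_interior (block k) (dist_X (next a) k) /\
  exists l, forall v, v \in block k ->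
    eta_loc p k * lhat a v - cgrad false 1 (X k v)
      + cgrad false 1 (dist_X (next a) k v) = l.
Proof.
move=> kU; have Xint : simplex_interior (block k) (X k) by case: st_good => _; apply.
have := argmin_mirror_step (fun=> false) (fun _ _ => ltr01) (eta_loc p k)
  (lhat a) (block_neq0 k) Xint.
by rewrite /= kU PhiE.
Qed.

Lemma next_good a : good (next a).
Proof. by split=> [|k kU]; [case: (next_Y a)|case: (next_X a kU)]. Qed.

(** * Exploration and stability of the global update *)

Variables (r gk : 'I_m -> R).
Hypothesis r_le : forall k, k \in U2 -> 0 < r k /\
  forall v, v \in block k -> r k <= \sum_(u in Nin E v :&: block k) gam_loc p t u.
Hypothesis gk_le : forall k, k \in U2 -> 0 < gk k /\
  forall v, v \in block k -> gk k <= \sum_(u in Nin E v :&: block k) gam p t u.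
(** When the estimate of [v] is used as the shift, it is at most the inverse of the probability of
    the other vertices. These inequalities then give the smallness conditions of [stability_sqrt]
    and [stability_entropy]. *)
Hypothesis explore_others : forall v, blk v \in U1NS ->
  [/\ 4 * eta p <= \sum_(u in [set~ v]) gam p t u,
      4 * eta_S p <= \sum_(u in [set~ v]) gam p t u
    & 2 * eta_NS p <= \sum_(u in [set~ v]) gam p t u].

Local Notation beta := ((1 - gbar)^-1).
Local Notation nu := ((U1NS != finset.set0)%:R : R).

Lemma gbar_gap : 0 < 1 - gbar. Proof. by rewrite subr_gt0. Qed.

Lemma beta_gt0 : 0 < beta. Proof. by rewrite invr_gt0 gbar_gap. Qed.

Lemma sum_Z_sub (A B : {set V}) : A \subset B -> \sum_(u in A) z u <= \sum_(u in B) z u.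
Proof.
move=> AB; rewrite [leRHS](big_setID A)/= (finset.setIidPr AB) lerDl.
by apply: sumr_ge0 => u _; exact/ltW/Z_gt0.
Qed.

Lemma inv_prob_U1S k v : k \in U1S -> v \in block k -> (P v)^-1 <= beta / Y k.
Proof.
move=> kS vb; rewrite -invfM lef_pV2 ?posrE ?prob_observed_gt0 ?mulr_gt0 ?gbar_gap ?Y_gt0//.
have := Z_ge_blk vb; rewrite /block_dist (negPf (U1S_notin_U2 kS)) mulr1.
move=> /le_trans; apply; have -> : z v = \sum_(u in [set v]%SET) z u by rewrite big_set1.
by apply: sum_Z_sub; rewrite finset.sub1set inE (U1S_loop legal kS vb).
Qed.

(** Only in-neighbours in the same block are kept, and of their probability only the part due to
    local exploration. *)
Lemma inv_prob_U2 k v : k \in U2 -> v \in block k -> (P v)^-1 <= beta / (Y k * r k).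
Proof.
move=> kU vb; have [r0 rv] := r_le kU.
rewrite -invfM lef_pV2 ?posrE ?prob_observed_gt0 ?mulr_gt0 ?gbar_gap ?Y_gt0//.
apply: (@le_trans _ _ (\sum_(u in Nin E v :&: block k) z u)); last first.
  exact/sum_Z_sub/subsetIl.
rewrite mulrA; apply: (@le_trans _ _ ((1 - gbar) * Y k *
    \sum_(u in Nin E v :&: block k) gam_loc p t u)).
  by rewrite ler_wpM2l ?rv// mulr_ge0 ?(ltW gbar_gap)// ltW// Y_gt0.
rewrite mulr_sumr; apply: ler_sum => u; rewrite inE => /andP[_ ub].
apply: le_trans (Z_ge_blk ub).
rewrite ler_wpM2l//; first by rewrite mulr_ge0 ?(ltW gbar_gap)// ltW// Y_gt0.
rewrite /block_dist kU lerDr mulr_ge0//.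
  by rewrite subr_ge0 ltW//; case: (gam_loc_ge0 kU).
by case: st_good => _ /(_ _ kU)[[h _ _] _].
Qed.

(** Here only the globally explored part is kept, so that [Y k] does not appear; the local regret
    relies on this. *)
Lemma inv_prob_gam k v : k \in U2 -> v \in block k -> (P v)^-1 <= (gk k)^-1.
Proof.
move=> kU vb; have [g0 gv] := gk_le kU.
rewrite lef_pV2 ?posrE ?prob_observed_gt0//; apply: le_trans (gv v vb) _.
apply: (@le_trans _ _ (\sum_(u in Nin E v :&: block k) z u)); last first.
  exact/sum_Z_sub/subsetIl.
by apply: ler_sum => u _; exact: Z_ge_gam.
Qed.

Lemma sum_Z_others v : \sum_(u in [set~ v]) z u = 1 - z v.
Proof.
rewrite -sum_Z [in RHS](bigD1 v)//= [RHS]addrAC subrr add0r.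
by apply: eq_bigl => u; rewrite !inE.
Qed.

Lemma prob_U1NS v : blk v \in U1NS -> P v = 1 - z v.
Proof. by move=> vN; rewrite -sum_Z_others /P (U1NS_Nin legal vN (block_blk blk v)). Qed.

Lemma expectation_le (f g h : V -> R) (c d B C : R) : 0 <= c -> 0 <= d ->
    (forall a, f a <= c * g a + d * h a) ->
    \sum_a z a * g a <= B -> \sum_a z a * h a <= C ->
  \sum_a z a * f a <= c * B + d * C.
Proof.
move=> c0 d0 fgh gB hC.
apply: (@le_trans _ _ (c * (\sum_a z a * g a) + d * (\sum_a z a * h a))).
  rewrite !mulr_sumr -big_split/=; apply: ler_sum => a _.
  apply: le_trans (ler_wpM2l (ltW (Z_gt0 a)) (fgh a)) _.
  by rewrite mulrDr !(mulrCA (z a)).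
by rewrite lerD// ler_wpM2l.
Qed.

Definition stab a k (sh : R) : R :=
  (Lh a k - sh) * (Y k - dist_Y (next a) k)
  - cbreg (kind k) (rate k) (dist_Y (next a) k) (Y k).

Lemma next_Y_ge0 a k : 0 <= dist_Y (next a) k.
Proof. by have [[[h _ _] _] _] := next_Y a. Qed.

Lemma stab_sqrt_le a k sh : kind k -> 0 <= sh -> 4 * rate k * sh <= 1 ->
  stab a k sh <= 2 * rate k * (Y k * Num.sqrt (Y k)) * Lh a k ^+ 2
    + 4 * rate k * (Y k * Num.sqrt (Y k)) * sh ^+ 2.
Proof.
move=> kk sh0 hs; rewrite /stab kk.
apply: stability_sqrt; rewrite ?coord_rate_gt0 ?Y_gt0 ?next_Y_ge0 ?Lh_ge0//.
apply: le_trans hs; rewrite -[leRHS]mulr1 mulrAC ler_wpM2l//.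
  by rewrite !mulr_ge0// ltW// coord_rate_gt0.
by rewrite -sqrtr1 ler_sqrt// Y_le1.
Qed.

Lemma stab_entropy_le a k sh : k \in U1NS -> 0 <= sh -> eta_NS p * sh <= 2^-1 ->
  stab a k sh <= eta_NS p / 2 * Y k * Lh a k ^+ 2 + 2 * eta_NS p * Y k * sh ^+ 2.
Proof.
move=> kN sh0 hs; rewrite /stab coord_kind_U1NS// coord_rate_U1NS//.
by case: eta_pos => _ _ ?; apply: stability_entropy;
  rewrite ?Y_gt0 ?next_Y_ge0 ?Lh_ge0.
Qed.

Lemma expected_stab_sqrt k (sh : V -> R) (B C : R) : kind k ->
    (forall a, 0 <= sh a) -> (forall a, 4 * rate k * sh a <= 1) ->
    (forall v, v \in block k -> (P v)^-1 <= B) -> \sum_a z a * sh a ^+ 2 <= C ->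
  \sum_a z a * stab a k (sh a)
    <= 2 * rate k * (Y k * Num.sqrt (Y k)) * B + 4 * rate k * (Y k * Num.sqrt (Y k)) * C.
Proof.
move=> kk sh0 hs PB shC.
have c0 : 0 <= rate k * (Y k * Num.sqrt (Y k)).
  by rewrite !mulr_ge0 ?sqrtr_ge0 ?(ltW (coord_rate_gt0 k)) ?(ltW (Y_gt0 k)).
apply: (expectation_le (g := fun a => Lh a k ^+ 2) (h := fun a => sh a ^+ 2)) => //.
- by rewrite -mulrA mulr_ge0.
- by rewrite -mulrA mulr_ge0.
- by move=> a; exact: stab_sqrt_le.
- exact: expectation_Lh_sqr.
Qed.

(** From [z v <= 1 / 2] the second moment is at most 2, which cancels the 1/2 of
    [stability_entropy]. *)
Lemma expected_stab_entropy v (sh : V -> R) (C : R) : blk v \in U1NS ->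
    (forall a, 0 <= sh a) -> (forall a, eta_NS p * sh a <= 2^-1) ->
    z v <= 2^-1 -> \sum_a z a * sh a ^+ 2 <= C ->
  \sum_a z a * stab a (blk v) (sh a)
    <= eta_NS p * Y (blk v) + 2 * eta_NS p * Y (blk v) * C.
Proof.
move=> vN sh0 hs zv shC; have [_ _ e0] := eta_pos; have y0 := Y_gt0 (blk v).
have -> : eta_NS p * Y (blk v) = eta_NS p / 2 * Y (blk v) * 2 by field.
apply: (expectation_le (g := fun a => Lh a (blk v) ^+ 2) (h := fun a => sh a ^+ 2)) => //.
- by rewrite mulr_ge0 ?(ltW y0)// divr_ge0 ?(ltW e0).
- by rewrite !mulr_ge0 ?(ltW y0) ?(ltW e0).
- by move=> a; exact: stab_entropy_le.
- apply: expectation_Lh_sqr => w; rewrite mem_block => /eqP wv.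
  rewrite (U1NS_inj legal vN wv) prob_U1NS//.
  by rewrite -[leRHS]invrK lef_pV2 ?posrE; lra.
Qed.

Lemma Lh_U1NS a v : blk v \in U1NS -> Lh a (blk v) = lhat a v.
Proof.
move=> vN; have := vN; rewrite in_U1NS => /andP[nU _].
rewrite LhatE (bigD1 v) ?block_blk//= big1 ?addr0.
  by rewrite /block_dist (negPf nU) mul1r.
move=> w /andP[]; rewrite mem_block => /eqP wv.
by rewrite (U1NS_inj legal vN wv) eqxx.
Qed.

Lemma kind_rate k : kind k -> rate k = eta p \/ rate k = eta_S p.
Proof.
rewrite /coord_kind in_U1NS negb_and !negbK => /orP[kU|kS].
  by left; exact: coord_rate_U2.
by right; exact: coord_rate_U1S.
Qed.

(* If some vertex without self-loop is played with probability more than 1/2, its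
   loss estimate has variance [1 / (1 - z v)], which may be large. Subtracting
   this estimate from all the coordinates leaves the update unchanged, and the
   other coordinates have total mass at most [beta * (1 - z v)]. *)
Lemma exists_shift : exists2 sh : V -> R, (forall a, 0 <= sh a) &
  exists C, [/\ forall a k, kind k -> 4 * rate k * sh a <= 1,
    \sum_a z a * sh a ^+ 2 <= C,
    forall k, kind k -> Y k * C <= nu * beta &
    \sum_(k in U1NS) \sum_a z a * stab a k (sh a)
      <= nu * (eta_NS p + 2 * eta_NS p * beta)].
Proof.
have [eU eS eN] := eta_pos; have b0 := beta_gt0.
have [vN|noN] := pickP (fun v => (blk v \in U1NS) && (2^-1 < z v)); last first.
  exists (fun=> 0) => //; exists 0; split=> [a k _|||].
  - by rewrite mulr0.
  - by rewrite big1// => a _; rewrite expr0n mulr0.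
  - by move=> k _; rewrite mulr0 mulr_ge0// ltW.
  have [->|N0] := eqVneq U1NS finset.set0; first by rewrite big_set0 mul0r.
  rewrite mul1r; apply: (@le_trans _ _ (\sum_(k in U1NS) eta_NS p * Y k)).
    apply: ler_sum => k kN; have /set0Pn[v] := block_neq0 k.
    rewrite mem_block => /eqP bv; rewrite -bv in kN *.
    rewrite -[leRHS]addr0 -[X in _ <= _ + X](mulr0 (2 * eta_NS p * Y (blk v))).
    apply: (@expected_stab_entropy v (fun=> 0) 0) => //.
    - by move=> a; rewrite mulr0.
    - by have := noN v; rewrite kN/= => /negbT; rewrite -leNgt.
    - by rewrite big1// => a _; rewrite expr0n mulr0.
  rewrite -mulr_sumr; apply: (@le_trans _ _ (eta_NS p * 1)).
    by rewrite ler_pM2l// sum_Y_le1.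
  by rewrite mulr1 lerDl !mulr_ge0// ltW.
case/andP=> kN zv; have kN0 : U1NS != finset.set0 by apply/set0Pn; exists (blk vN).
rewrite kN0 !mul1r; set Q := 1 - z vN.
have PQ : P vN = Q by exact: prob_U1NS.
have Q0 : 0 < Q by rewrite -PQ; exact: prob_observed_gt0.
have GQ : \sum_(u in [set~ vN]) gam p t u <= Q.
  by rewrite /Q -sum_Z_others; apply: ler_sum => u _; exact: Z_ge_gam.
have [g1 g2 g3] := explore_others kN.
have shQ a : lhat a vN <= Q^-1 by rewrite -PQ; exact: lhat_le.
(* [Q] is the probability of not playing [vN], and every block is played with probability at least
   [(1 - gbar) * Y k]. *)
have massQ (A : {set 'I_m}) : blk vN \notin A -> \sum_(k in A) Y k <= beta * Q.
  move=> nA; rewrite -ler_pdivrMl// invrK mulr_sumr.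
  apply: (@le_trans _ _ (\sum_(k in A) \sum_(v in block k) z v)).
    by apply: ler_sum => k _; exact: mass_block.
  rewrite lerBrDr -sum_Z (sum_blocks blk) [leRHS](bigID (mem A))/= lerD2l.
  rewrite [leRHS](bigD1 (blk vN))//= [X in _ <= X + _](bigD1 vN) ?block_blk//=.
  rewrite -addrA lerDl addr_ge0//; first by apply: sumr_ge0 => v _; exact/ltW/Z_gt0.
  by apply: sumr_ge0 => k _; apply: sumr_ge0 => v _; exact/ltW/Z_gt0.
have massk k : k != blk vN -> Y k * Q^-1 <= beta.
  move=> kv; rewrite ler_pdivrMr//; have := massQ [set k]%SET.
  by rewrite big_set1; apply; rewrite inE eq_sym.
have neq k : kind k -> k != blk vN.
  by move=> kk; apply: contraNneq kk => ->.
exists (fun a => lhat a vN); first by move=> a; exact: lhat_ge0.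
exists Q^-1; split=> [a k kk||k kk|].
- apply: (@le_trans _ _ (Q * Q^-1)); last by rewrite divff// gt_eqF.
  apply: ler_pM => //.
  + by rewrite mulr_ge0// ltW// coord_rate_gt0.
  + exact: lhat_ge0.
  + by case: (kind_rate kk) => ->; lra.
- by rewrite -PQ; exact: expectation_lhat_sqr.
- exact/massk/neq.
(* At the coordinate of [vN] the estimate equals the shift, and only minus a divergence is left. *)
rewrite (bigD1 (blk vN))//= -[leRHS]add0r; apply: lerD.
  rewrite -oppr_ge0 -sumrN; apply: sumr_ge0 => a _.
  rewrite -mulrN mulr_ge0 ?(ltW (Z_gt0 a))// /stab Lh_U1NS// subrr mul0r add0r opprK.
  by rewrite cbreg_ge0 ?coord_rate_gt0 ?next_Y_ge0 ?Y_gt0.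
pose N' := (U1NS :\ blk vN)%SET.
have N'E k : (k \in N') = (k \in U1NS) && (k != blk vN) by rewrite finset.in_setD1 andbC.
rewrite -(eq_bigl _ _ N'E).
apply: (@le_trans _ _ (\sum_(k in N') (eta_NS p * Y k + 2 * eta_NS p * Y k * Q^-1))).
  apply: ler_sum => k; rewrite N'E => /andP[kN' kv].
  have /set0Pn[v] := block_neq0 k; rewrite mem_block => /eqP bv.
  rewrite -bv in kN' kv *; apply: expected_stab_entropy => //.
  - by move=> a; exact: lhat_ge0.
  - move=> a; apply: (@le_trans _ _ (eta_NS p * Q^-1)).
      by rewrite ler_pM2l.
    by rewrite ler_pdivrMr//; lra.
  (* Two distinct vertices cannot both have probability above 1/2. *)
  - have : z v + z vN <= 1.
      rewrite -sum_Z (bigD1 vN)//= (bigD1 v)/=; last by apply: contraNneq kv => ->.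
      by rewrite [leLHS]addrC lerD2l lerDl; apply: sumr_ge0 => u _; exact/ltW/Z_gt0.
    by lra.
  - by rewrite -PQ; exact: expectation_lhat_sqr.
rewrite big_split/= -mulr_suml -!mulr_sumr lerD//.
  by rewrite -[leRHS]mulr1 ler_pM2l// sum_Y_le1.
rewrite -mulrA ler_pM2l ?mulr_gt0// ler_pdivrMr//.
by apply: massQ; rewrite !inE eqxx.
Qed.

Definition stability_bound : R :=
  2 * eta p * beta * Num.sqrt (\sum_(k in U2) (r k)^-1 ^+ 2)
  + 2 * eta_S p * beta * Num.sqrt #|U1S|%:R
  + nu * (4 * eta p * beta * Num.sqrt #|U2|%:R
          + 4 * eta_S p * beta * Num.sqrt #|U1S|%:R
          + (eta_NS p + 2 * eta_NS p * beta)).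

(** In the square-root sums one factor [Y k] of the weight [Y k * sqrt (Y k)] is spent against the
    variance of the estimate, or against [C] for the shift. What remains is linear in [sqrt (Y k)],
    ready for Cauchy-Schwarz. *)
Lemma expected_stability : exists sh : V -> R,
  \sum_a z a * \sum_k stab a k (sh a) <= stability_bound.
Proof.
have [eU eS eN] := eta_pos; have b0 := beta_gt0.
have nu0 : 0 <= nu by [].
have [sh sh0 [C [shk shC YC shN]]] := exists_shift.
exists sh; under eq_bigr do rewrite mulr_sumr.
rewrite exchange_big/= (sum_split3 E s blk).
have boundU : \sum_(k in U2) \sum_a z a * stab a k (sh a) <=
    2 * eta p * beta * Num.sqrt (\sum_(k in U2) (r k)^-1 ^+ 2)
    + nu * (4 * eta p * beta * Num.sqrt #|U2|%:R).
  apply: (@le_trans _ _ (\sum_(k in U2) (2 * eta p * beta * ((r k)^-1 * Num.sqrt (Y k))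
      + nu * (4 * eta p * beta) * Num.sqrt (Y k)))).
    apply: ler_sum => k kU; have kk := coord_kind_U2 E blk kU.
    apply: le_trans (expected_stab_sqrt kk sh0 (fun a => shk a k kk)
      (fun v => @inv_prob_U2 k v kU) shC) _.
    have [r0 _] := r_le kU; have y0 := Y_gt0 k; rewrite coord_rate_U2//.
    apply: lerD.
      rewrite le_eqVlt; apply/orP; left; apply/eqP; field.
      by rewrite !gt_eqF// gbar_gap.
    have := ler_wpM2l (sqrtr_ge0 (Y k)) (YC k kk).
    have := ler_wpM2l (ltW eU) (ler_wpM2l (sqrtr_ge0 (Y k)) (YC k kk)); lra.
  rewrite big_split/= -!mulr_sumr lerD//.
    rewrite ler_wpM2l ?mulr_ge0 ?(ltW eU) ?(ltW b0)//.
    by apply: sum_mul_sqrt_le; [move=> k; exact/ltW/Y_gt0|exact: sum_Y_le1].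
  rewrite [leRHS]mulrA ler_wpM2l//.
    by rewrite mulr_ge0// mulr_ge0 ?mulr_ge0 ?(ltW eU) ?(ltW b0).
  by apply: sum_sqrt_le; [move=> k; exact/ltW/Y_gt0|exact: sum_Y_le1].
have boundS : \sum_(k in U1S) \sum_a z a * stab a k (sh a) <=
    (2 * eta_S p * beta + nu * (4 * eta_S p * beta)) * Num.sqrt #|U1S|%:R.
  apply: (@le_trans _ _ (\sum_(k in U1S)
      (2 * eta_S p * beta + nu * (4 * eta_S p * beta)) * Num.sqrt (Y k))).
    apply: ler_sum => k kS; have kk := coord_kind_U1S kS.
    apply: le_trans (expected_stab_sqrt kk sh0 (fun a => shk a k kk)
      (fun v => @inv_prob_U1S k v kS) shC) _.
    have y0 := Y_gt0 k; rewrite coord_rate_U1S// [leRHS]mulrDl.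
    apply: lerD.
      rewrite le_eqVlt; apply/orP; left; apply/eqP; field.
      by rewrite !gt_eqF// gbar_gap.
    have := ler_wpM2l (ltW eS) (ler_wpM2l (sqrtr_ge0 (Y k)) (YC k kk)); lra.
  rewrite -mulr_sumr ler_wpM2l//.
    by rewrite addr_ge0 ?mulr_ge0 ?(ltW eS) ?(ltW b0).
  by apply: sum_sqrt_le; [move=> k; exact/ltW/Y_gt0|exact: sum_Y_le1].
rewrite /stability_bound; lra.
Qed.

(** * One-round regret against a fixed arm *)

Variable a0 : V.
Local Notation k0 := (blk a0).

Definition comparator (k : 'I_m) : R := (k == k0)%:R.
Definition block_comparator (v : V) : R := (v == a0)%:R.

(** The regret against [a0] splits into the global regret against its block and the local regret
    inside it, so only that block contributes a local divergence. The division by [eta_loc] is due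
    to this rate multiplying the losses instead of sitting in the potential. *)
Definition lyapunov (st' : @state R V m) : R :=
  sepbreg [set: 'I_m]%SET kind rate comparator (dist_Y st')
  + if k0 \in U2 then
      sepbreg (block k0) (fun=> false) (fun=> 1) block_comparator (dist_X st' k0)
      / eta_loc p k0
    else 0.

Lemma simplex_dirac (I : finType) (A : {set I}) (i : I) : i \in A ->
  simplex A (fun j => (j == i)%:R : R).
Proof.
move=> iA; split=> [j|j|].
- by [].
- by apply: contraNeq; rewrite pnatr_eq0 eqb0 negbK => /eqP ->.
- rewrite (bigD1 i)//= eqxx big1 ?addr0// => j /andP[_ /negPf ->]; exact: erefl.
Qed.

Lemma global_regret :
  \sum_k Y k * (\sum_(v in block k) q k v * ell v)
    - \sum_(v in block k0) q k0 v * ell v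
    + \sum_a z a * sepbreg [set: 'I_m]%SET kind rate comparator (dist_Y (next a))
  <= sepbreg [set: 'I_m]%SET kind rate comparator Y + stability_bound.
Proof.
have [sh shB] := expected_stability.
have cS : simplex [set: 'I_m]%SET comparator by apply: simplex_dirac; rewrite finset.in_setT.
have [_ _ c1] := cS; have [[[_ _ y1] _] _] := st_good.
have id a : \sum_k Lh a k * (Y k - comparator k) +
    sepbreg [set: 'I_m]%SET kind rate comparator (dist_Y (next a)) =
    sepbreg [set: 'I_m]%SET kind rate comparator Y + \sum_k stab a k (sh a).
  have [yint [l hl]] := next_Y a.
  pose c := \sum_(i in U1NS) Lh a i * Y i.
  (* The losses are already reduced by [c], so the further shift [sh a - c] leaves [Lh a k - sh a]:
     the shift of the analysis takes the place of that of the algorithm. *)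
  have := mirror_descent_identity (fun k _ => coord_rate_gt0 k) (sh a - c) cS
    (proj1 st_good) yint hl.
  rewrite (eq_bigr (fun k => Lh a k * (Y k - comparator k) - (c * Y k - c * comparator k))); last first.
    by move=> k _; rewrite /Lhat' -/c; ring.
  rewrite sumrB sumrB -!mulr_sumr y1 c1 subrr subr0.
  rewrite (eq_bigl xpredT) => [->|k]; last by rewrite finset.in_setT.
  rewrite addrAC subrK; congr (_ + _).
  rewrite (eq_bigl xpredT) => [|k]; last by rewrite finset.in_setT.
  by apply: eq_bigr => k _; rewrite /stab /Lhat' -/c; congr (_ * _ - _); ring.
have -> : \sum_k Y k * (\sum_(v in block k) q k v * ell v)
    - \sum_(v in block k0) q k0 v * ell v =
    \sum_a z a * \sum_k Lh a k * (Y k - comparator k).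
  under [RHS]eq_bigr do rewrite mulr_sumr.
  rewrite exchange_big/= [X in _ - X](_ : _ =
    \sum_k comparator k * \sum_(v in block k) q k v * ell v); last first.
    rewrite [RHS](bigD1 k0)//= /comparator eqxx mul1r [X in _ = _ + X]big1 ?addr0// => k /negPf ->.
    by rewrite mul0r.
  rewrite -sumrB; apply: eq_bigr => k _; rewrite -mulrBl -expectation_Lh mulr_sumr.
  by apply: eq_bigr => a _; ring.
rewrite -big_split/=.
apply: (@le_trans _ _ (\sum_a z a * (sepbreg [set: 'I_m]%SET kind rate comparator Y
   + \sum_k stab a k (sh a)))).
  by apply: ler_sum => a _; rewrite -mulrDr id.
under eq_bigr do rewrite mulrDr.
by rewrite big_split/= -mulr_suml sum_Z mul1r lerD2l.
Qed.

(** Entropic mirror descent with zero shift. The average is over all the arms played, with no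
    conditioning on the block, and the regret is that of [X], the point which mirror descent moves,
    not of its mixture with exploration. *)
Lemma local_regret : k0 \in U2 ->
  \sum_(v in block k0) X k0 v * ell v - ell a0
    + \sum_a z a * (sepbreg (block k0) (fun=> false) (fun=> 1) block_comparator
                      (dist_X (next a) k0) / eta_loc p k0)
  <= sepbreg (block k0) (fun=> false) (fun=> 1) block_comparator (X k0) / eta_loc p k0
     + eta_loc p k0 / (2 * gk k0).
Proof.
move=> kU; have e0 := eta_loc_pos kU.
have [g0 _] := gk_le kU.
have cS : simplex (block k0) block_comparator by exact/simplex_dirac/block_blk.
have Xint : simplex_interior (block k0) (X k0) by case: st_good => _; apply.
have [[X0 _ X1] Xp] := Xint.
have id a : \sum_(v in block k0) lhat a v * (X k0 v - block_comparator v) +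
    sepbreg (block k0) (fun=> false) (fun=> 1) block_comparator (dist_X (next a) k0)
      / eta_loc p k0
    <= sepbreg (block k0) (fun=> false) (fun=> 1) block_comparator (X k0) / eta_loc p k0
    + eta_loc p k0 / 2 * \sum_(v in block k0) X k0 v * lhat a v ^+ 2.
  have [xint [l hl]] := next_X a kU.
  have [[x'0 _ _] _] := xint.
  have idl := mirror_descent_identity (fun _ _ => ltr01) 0 cS Xint xint hl.
  have stabl : \sum_(v in block k0) ((eta_loc p k0 * lhat a v - 0)
      * (X k0 v - dist_X (next a) k0 v) - cbreg false 1 (dist_X (next a) k0 v) (X k0 v))
      <= \sum_(v in block k0) eta_loc p k0 ^+ 2 / 2 * (X k0 v * lhat a v ^+ 2).
    apply: ler_sum => v vb.
    have l0 : 0 <= eta_loc p k0 * lhat a v by rewrite mulr_ge0 ?lhat_ge0// ltW.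
    have := @stability_entropy R 1 (X k0 v) (dist_X (next a) k0 v)
      (eta_loc p k0 * lhat a v) 0 ltr01 (Xp v vb) (x'0 v) l0 (lexx 0).
    rewrite mulr0 invr_ge0 => /(_ (ler0n _ _)); rewrite expr0n/= mulr0 addr0.
    by move=> /le_trans; apply; rewrite le_eqVlt; apply/orP; left; apply/eqP; ring.
  have eA : eta_loc p k0 * \sum_(v in block k0) lhat a v * (X k0 v - block_comparator v)
      = \sum_(v in block k0) eta_loc p k0 * lhat a v * (X k0 v - block_comparator v).
    by rewrite mulr_sumr; apply: eq_bigr => v _; rewrite mulrA.
  move: idl stabl; rewrite -eA -mulr_sumr.
  set A := \sum_(v in _) _; set S := \sum_(v in _) (X k0 v * _).
  set D := sepbreg _ _ _ _ (X k0); set D' := sepbreg _ _ _ _ _.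
  move=> idl stabl; rewrite -(ler_pM2l e0).
  have -> : eta_loc p k0 * (A + D' / eta_loc p k0) = eta_loc p k0 * A + D'.
    by field; rewrite gt_eqF.
  have -> : eta_loc p k0 * (D / eta_loc p k0 + eta_loc p k0 / 2 * S)
    = D + eta_loc p k0 ^+ 2 / 2 * S by field; rewrite gt_eqF.
  lra.
have -> : \sum_(v in block k0) X k0 v * ell v - ell a0 =
    \sum_a z a * \sum_(v in block k0) lhat a v * (X k0 v - block_comparator v).
  under [RHS]eq_bigr do rewrite mulr_sumr.
  rewrite exchange_big/= [X in _ - X](_ : _ =
    \sum_(v in block k0) block_comparator v * ell v); last first.
    rewrite (bigD1 a0) ?block_blk//= /block_comparator eqxx mul1r big1 ?addr0//.
    by move=> v /andP[_ /negPf ->]; rewrite mul0r.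
  rewrite -sumrB; apply: eq_bigr => v _; rewrite -mulrBl -(expectation_lhat v) mulr_sumr.
  by apply: eq_bigr => a _; ring.
rewrite -big_split/=.
apply: (@le_trans _ _ (\sum_a z a *
    (sepbreg (block k0) (fun=> false) (fun=> 1) block_comparator (X k0) / eta_loc p k0
    + eta_loc p k0 / 2 * \sum_(v in block k0) X k0 v * lhat a v ^+ 2))).
  by apply: ler_sum => a _; rewrite -mulrDr ler_wpM2l ?(ltW (Z_gt0 a)).
under eq_bigr do rewrite mulrDr.
rewrite big_split/= -mulr_suml sum_Z mul1r lerD2l.
have -> : eta_loc p k0 / (2 * gk k0) = eta_loc p k0 / 2 * (gk k0)^-1.
  by field; rewrite gt_eqF.
under eq_bigr do rewrite mulrCA.
rewrite -mulr_sumr ler_pM2l ?divr_gt0//.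
under eq_bigr do rewrite mulr_sumr.
rewrite exchange_big/= -[leRHS]mul1r -X1 mulr_suml; apply: ler_sum => v vb.
under eq_bigr do rewrite mulrCA.
rewrite -mulr_sumr ler_wpM2l//.
exact: le_trans (expectation_lhat_sqr v) (inv_prob_gam kU vb).
Qed.

Definition local_bound : R :=
  if k0 \in U2 then
    \sum_(v in block k0) gam_loc p t v + eta_loc p k0 / (2 * gk k0)
  else 0.

(** The regrets of the two levels telescope through the mean loss of the block of [a0]. Since losses
    are at most 1, passing from [Z] to the mixture by [Y] costs [gbar], and passing from [Xtilde] to
    [X] costs the local exploration mass. *)
Lemma round_bound :
  \sum_a z a * (ell a + lyapunov (next a))
    <= ell a0 + gbar + local_bound + stability_bound + lyapunov st.
Proof.
have loss : \sum_a z a * ell a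
    <= \sum_k Y k * (\sum_(v in block k) q k v * ell v) + gbar.
  rewrite (eq_bigr (fun a => (1 - gbar) * Y (blk a) * q (blk a) a * ell a
    + gam p t a * ell a)); last by move=> a _; rewrite {1}ZE; ring.
  rewrite big_split/= lerD//; last first.
    apply: ler_sum => a _; have [_ l1] := andP (ell01 a).
    by rewrite -[leRHS]mulr1 ler_wpM2l.
  rewrite (sum_blocks blk); apply: ler_sum => k _; rewrite mulr_sumr.
  apply: ler_sum => v vb; have := vb; rewrite mem_block => /eqP bv; rewrite bv.
  have [l0 _] := andP (ell01 v).
  have : 0 <= Y k * (q k v * ell v).
    by rewrite !mulr_ge0 ?(ltW (Y_gt0 k)) ?(ltW (block_dist_gt0 vb)).
  by have := gbar_ge0; nra.
have glob := global_regret.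
have split_pot : \sum_a z a * (ell a + lyapunov (next a)) = \sum_a z a * ell a +
    (\sum_a z a * sepbreg [set: 'I_m]%SET kind rate comparator (dist_Y (next a)) +
     if k0 \in U2 then
      \sum_a z a * (sepbreg (block k0) (fun=> false) (fun=> 1) block_comparator
                      (dist_X (next a) k0) / eta_loc p k0) else 0).
  under eq_bigr do rewrite mulrDr.
  rewrite big_split/=; congr (_ + _); rewrite /lyapunov.
  under eq_bigr do rewrite mulrDr.
  rewrite big_split/=; congr (_ + _); case: (k0 \in U2) => //.
  by rewrite big1// => a _; rewrite mulr0.
rewrite split_pot /local_bound [in leRHS]/lyapunov.
have [kU|kU] := ifPn (k0 \in U2).
  have lreg := local_regret kU.
  have mix : \sum_(v in block k0) q k0 v * ell v
      <= \sum_(v in block k0) X k0 v * ell v + \sum_(v in block k0) gam_loc p t v.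
    rewrite -big_split/=; apply: ler_sum => v vb.
    rewrite /block_dist kU /Xtilde.
    have [l0 l1] := andP (ell01 v); have [gl0 _] := gam_loc_ge0 kU.
    have x0 : 0 <= X k0 v by case: st_good => _ /(_ _ kU)[[h _ _] _].
    have G0 : 0 <= \sum_(u in block k0) gam_loc p t u by exact: sumr_ge0.
    have : 0 <= X k0 v * ell v * \sum_(u in block k0) gam_loc p t u.
      by rewrite !mulr_ge0.
    have : gam_loc p t v * ell v <= gam_loc p t v * 1 by rewrite ler_wpM2l// gl0.
    by lra.
  lra.
have sing : \sum_(v in block k0) q k0 v * ell v = ell a0.
  have [v bv] := block_singleton legal kU.
  have := block_blk blk a0; rewrite bv big_set1 inE => /eqP <-.
  by rewrite /block_dist (negPf kU) mul1r.
rewrite -sing; lra.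
Qed.
End FixedRound.

(** * Initial divergence and regret over all rounds *)

Lemma seppot_comparator_le0 (a0 : V) :
  seppot [set: 'I_m]%SET kind rate (comparator a0) <= 0.
Proof.
apply: sumr_le0 => k _; rewrite /cpot /comparator.
case: (kind k).
  by rewrite mulNr oppr_le0 divr_ge0 ?sqrtr_ge0// ltW// coord_rate_gt0.
by case: (k == blk a0); rewrite ?ln1 ?mulr0 ?mul0r.
Qed.

(** The mass on [A] may be below 1, and then [ln #|A|] can fail as a bound: it is 0 for a single
    coordinate. Taking [M = #|A| + 1] treats the missing mass as one more coordinate. *)
Lemma entropy_part_le (A : {set 'I_m}) (y : 'I_m -> R) :
    (forall k, 0 <= y k) -> \sum_(k in A) y k <= 1 ->
  - \sum_(k in A) y k * ln (y k) <= ln (#|A|%:R + 1).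
Proof.
move=> y0 y1; set M : R := #|A|%:R + 1.
have M0 : 0 < M by rewrite ltr_wpDl.
have q0 : 0 <= \sum_(k in A) y k by exact: sumr_ge0.
apply: le_trans (entropy_le A M0 y0) _; set S := \sum_(k in A) y k in q0 y1 *.
have -> : #|A|%:R / M = 1 - M^-1 by rewrite /M; field; rewrite gt_eqF.
have iM : 0 < M^-1 by rewrite invr_gt0.
have := expR_ge1Dx (- ln M); rewrite expRN lnK ?posrE// => h.
have : 0 <= (1 - S) * (M^-1 - (1 - ln M)) by rewrite mulr_ge0 ?subr_ge0.
have : 0 <= S * M^-1 by rewrite mulr_ge0// ltW.
lra.
Qed.

Definition initial_bound (a0 : V) : R :=
  Num.sqrt #|U2|%:R / eta p + Num.sqrt #|U1S|%:R / eta_S p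
  + ln (#|U1NS|%:R + 1) / eta_NS p
  + if blk a0 \in U2 then ln #|block (blk a0)|%:R / eta_loc p (blk a0) else 0.

(** A Dirac comparator has nonpositive global potential and zero entropy, so each divergence is at
    most minus the potential of the starting point. *)
Lemma lyapunov_init (a0 : V) :
  lyapunov a0 (init_state E s blk p) <= initial_bound a0.
Proof.
have [eU eS eN] := eta_pos; rewrite /lyapunov /initial_bound /=; apply: lerD.
  rewrite PsiE; have [yint kkt] := argmin_seppot kind (fun k _ => coord_rate_gt0 k) (ord_set_neq0 a0).
  set y := argmin _ _ in yint kkt *.
  have cS : simplex [set: 'I_m]%SET (comparator a0).
    by apply: simplex_dirac; rewrite finset.in_setT.
  rewrite (sepbreg_argmin (fun k _ => coord_rate_gt0 k) cS yint kkt).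
  have := seppot_comparator_le0 a0; set S0 := seppot _ _ _ (comparator a0) => S00.
  suff : - seppot [set: 'I_m]%SET kind rate y <= Num.sqrt #|U2|%:R / eta p
      + Num.sqrt #|U1S|%:R / eta_S p + ln (#|U1NS|%:R + 1) / eta_NS p by lra.
  have [[y0 _ y1] _] := yint.
  have yA (A : {set 'I_m}) : \sum_(k in A) y k <= 1.
    rewrite -y1 [leRHS](bigID (mem A))/=.
    rewrite [X in _ <= X + _](eq_bigl (fun k => k \in A)); last by move=> k; rewrite finset.in_setT.
    by rewrite lerDl; apply: sumr_ge0.
  rewrite /seppot (eq_bigl xpredT) => [|k]; last by rewrite finset.in_setT.
  rewrite (sum_split3 E s blk) !opprD -!sumrN.
  apply: lerD; first apply: lerD.
  - apply: (@le_trans _ _ ((\sum_(k in U2) Num.sqrt (y k)) / eta p)).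
      rewrite mulr_suml; apply: ler_sum => k kU.
      by rewrite /cpot coord_kind_U2// coord_rate_U2// mulNr opprK.
    by rewrite ler_pM2r ?invr_gt0//; exact: sum_sqrt_le.
  - apply: (@le_trans _ _ ((\sum_(k in U1S) Num.sqrt (y k)) / eta_S p)).
      rewrite mulr_suml; apply: ler_sum => k kU.
      by rewrite /cpot coord_kind_U1S// coord_rate_U1S// mulNr opprK.
    by rewrite ler_pM2r ?invr_gt0//; exact: sum_sqrt_le.
  - apply: (@le_trans _ _ (- (\sum_(k in U1NS) y k * ln (y k)) / eta_NS p)).
      rewrite mulNr mulr_suml -sumrN; apply: ler_sum => k kU.
      by rewrite /cpot coord_kind_U1NS// coord_rate_U1NS.
    by rewrite ler_pM2r ?invr_gt0//; exact: entropy_part_le.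
case: ifP => // kU; rewrite kU ler_pM2r ?invr_gt0 ?eta_loc_pos// PhiE.
have [yint kkt] := argmin_seppot (e := fun=> 1 : R) (fun=> false) (fun _ _ => ltr01) (block_neq0 (blk a0)).
set y := argmin _ _ in yint kkt *.
have cS : simplex (block (blk a0)) (block_comparator a0) by exact/simplex_dirac/block_blk.
rewrite (sepbreg_argmin (fun _ _ => ltr01) cS yint kkt).
have -> : seppot (block (blk a0)) (fun=> false) (fun=> 1) (block_comparator a0) = 0.
  apply: big1 => v _; rewrite /cpot /block_comparator.
  by case: (v == a0); rewrite ?ln1 ?mulr0 ?mul0r.
have [[y0 _ y1] _] := yint.
have n0 : 0 < #|block (blk a0)|%:R :> R by rewrite ltr0n card_gt0 block_neq0.
have := entropy_le (block (blk a0)) n0 y0; rewrite y1 divff ?gt_eqF// mul1r addrK.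
move=> h; rewrite sub0r /seppot; under eq_bigr do rewrite /cpot /= divr1.
exact: h.
Qed.

Lemma lyapunov_ge0 (a0 : V) st : good st -> 0 <= lyapunov a0 st.
Proof.
move=> [Yint Xint]; apply: addr_ge0.
  apply: sepbreg_ge0 => //; first by move=> k _; exact: coord_rate_gt0.
  by apply: simplex_dirac; rewrite finset.in_setT.
case: ifP => // kU; rewrite divr_ge0 ?(ltW (eta_loc_pos kU))//.
apply: sepbreg_ge0 => //; last exact: Xint.
exact/simplex_dirac/block_blk.
Qed.

End Round.

Lemma regret_bound (R : realType) (V : finType) (m s : nat) (E : rel V)
    (blk : V -> 'I_m) (p : params R V m) (g gl : V -> R) (r gk : 'I_m -> R)
    (ell : nat -> V -> R) (T : nat) (a : V) (b : R) :
    legal_partition E s blk ->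
    [/\ 0 < eta p, 0 < eta_S p & 0 < eta_NS p] ->
    (forall k, k \in @U2 m s -> 0 < eta_loc p k) ->
    (forall t, gam p t = g) -> (forall t, gam_loc p t = gl) ->
    (forall v, 0 <= g v) -> \sum_v g v < 1 ->
    (forall k, k \in @U2 m s -> (forall v, v \in block blk k -> 0 <= gl v) /\
       \sum_(v in block blk k) gl v < 1) ->
    (forall k, k \in @U2 m s -> 0 < r k /\
       forall v, v \in block blk k -> r k <= \sum_(u in Nin E v :&: block blk k) gl u) ->
    (forall k, k \in @U2 m s -> 0 < gk k /\
       forall v, v \in block blk k -> gk k <= \sum_(u in Nin E v :&: block blk k) g u) ->
    (forall v, blk v \in U1NS E s blk ->
      [/\ 4 * eta p <= \sum_(u in [set~ v]) g u,
          4 * eta_S p <= \sum_(u in [set~ v]) g u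
        & 2 * eta_NS p <= \sum_(u in [set~ v]) g u]) ->
    (forall t v, (t < T)%N -> 0 <= ell t v <= 1) ->
    b = (1 - \sum_v g v)^-1 ->
  regret E s blk p ell T a
    <= Num.sqrt #|@U2 m s|%:R / eta p + Num.sqrt #|U1S E s blk|%:R / eta_S p
       + ln (#|U1NS E s blk|%:R + 1) / eta_NS p
       + (if blk a \in @U2 m s
          then ln #|block blk (blk a)|%:R / eta_loc p (blk a) else 0)
     + T%:R * (\sum_v g v
       + (if blk a \in @U2 m s
          then \sum_(v in block blk (blk a)) gl v + eta_loc p (blk a) / (2 * gk (blk a))
          else 0)
       + (2 * eta p * b * Num.sqrt (\sum_(k in @U2 m s) (r k)^-1 ^+ 2)
          + 2 * eta_S p * b * Num.sqrt #|U1S E s blk|%:R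
          + (U1NS E s blk != finset.set0)%:R *
            (4 * eta p * b * Num.sqrt #|@U2 m s|%:R
             + 4 * eta_S p * b * Num.sqrt #|U1S E s blk|%:R
             + (eta_NS p + 2 * eta_NS p * b)))).
Proof.
move=> legal eta0 etal0 gE glE g0 g1 gl0 r0 gk0 expl ell01 -> {b}.
set b := (1 - _)^-1.
set c := (X in T%:R * X); rewrite /regret.
have := @drift_bound R V m E s blk p ell (good s blk) (lyapunov E s blk p a)
  (fun t => ell t a + c) T (init_good legal eta0 a).
rewrite big_split/= sumr_const card_ord -[c *+ T]mulr_natl => drift.
rewrite lerBlDr; apply: le_trans (drift _ _) _; last first.
- rewrite addrCA [leRHS]addrC lerD2l lerD2r.
  exact: lyapunov_init.
- by move=> st; exact: lyapunov_ge0.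
move=> t st tT st_good.
have ellt v : 0 <= ell t v <= 1 by exact: ell01.
have g0t v : 0 <= gam p t v by rewrite gE.
have g1t : \sum_v gam p t v < 1 by rewrite gE.
have gl0t k : k \in @U2 m s -> (forall v, v \in block blk k -> 0 <= gam_loc p t v) /\
       \sum_(v in block blk k) gam_loc p t v < 1 by rewrite glE; exact: gl0.
split.
- by move=> v; apply/ltW/Z_gt0.
- exact: (sum_Z legal).
- by move=> v; apply: next_good.
have := @round_bound R V m E s blk legal p eta0 etal0 t st (ell t) st_good ellt g0t g1t gl0t r gk.
rewrite gE glE => /(_ r0 gk0 expl a) /le_trans; apply.
by rewrite lerD2r /local_bound /stability_bound gE glE /c !addrA.
Qed.

(** * Choice of the parameters *)

Section Tuning.
Context {R : realType} {V : finType} {m : nat}.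
Variables (E : rel V) (s : nat) (blk : V -> 'I_m).
Hypothesis legal : legal_partition E s blk.

Local Notation U2 := (@U2 m s).
Local Notation U1S := (U1S E s blk).
Local Notation U1NS := (U1NS E s blk).
Local Notation block := (block blk).
Local Notation delta := (delta_star E blk R).
Local Notation D2 := (\sum_(k in U2) delta k ^+ 2).
Local Notation Dlog := (\sum_(k in U2) delta k * ln (#|block k|%:R)).
Local Notation nu := ((U1NS != finset.set0)%:R : R).

Lemma U2_observable k : k \in U2 -> observable_on E (block k).
Proof. by case: legal => _ _ _ _ h /h[]. Qed.

Lemma delta_ge1 k : k \in U2 -> 1 <= delta k.
Proof.
by move=> kU; apply: delta_star_ge1; [exact: U2_observable|case: legal].
Qed.

Lemma ln_block_gt0 k : k \in U2 -> 0 < ln #|block k|%:R :> R.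
Proof. by case: legal => _ _ _ _ h /h[n1 _]; rewrite ln_gt0// ltr1n. Qed.

Lemma card_U2_le_D2 : #|U2|%:R <= D2.
Proof.
rewrite -sumr_const; apply: ler_sum => k kU.
by rewrite expr_ge1 ?delta_ge1// (le_trans ler01)// delta_ge1.
Qed.

Lemma Dlog_gt0 : U2 != finset.set0 -> 0 < Dlog.
Proof.
move=> /set0Pn[k kU]; rewrite (bigD1 k)//= ltr_pwDl//.
  by rewrite mulr_gt0 ?ln_block_gt0// (lt_le_trans ltr01)// delta_ge1.
apply: sumr_ge0 => i /andP[iU _].
by rewrite mulr_ge0 ?(ltW (ln_block_gt0 iU))// (le_trans ler01)// delta_ge1.
Qed.

(** Both factors are multiples of optimal vectors of the programs. Local weights [h / delta k] give
    every block the same explored mass [h]; global weights [G * ln #|block k|] will make the local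
    regret bound the same in all blocks, hence independent of the comparator. *)
Lemma exists_exploration (G h : R) : 0 < G -> 0 < h ->
  exists g gl : V -> R,
    [/\ forall v, 0 <= g v, \sum_v g v = G * Dlog,
        forall v, blk v \notin U2 -> g v = 0 &
        forall k, k \in U2 ->
          [/\ forall v, v \in block k -> 0 <= gl v,
              \sum_(v in block k) gl v = h,
              forall v, v \in block k ->
                h / delta k <= \sum_(u in Nin E v :&: block k) gl u
            & forall v, v \in block k ->
                G * ln #|block k|%:R <= \sum_(u in Nin E v :&: block k) g u]].
Proof.
move=> G0 h0.
have /choice[x hx] : forall k : 'I_m, exists x : V -> R, k \in U2 ->
    [/\ forall v, 0 <= x v <= 1,
        forall u, u \in block k -> 1 <= \sum_(v in Nin E u :&: block k) x v
      & \sum_(v in block k) x v = delta k].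
  move=> k; have [kU|kU] := boolP (k \in U2); last by exists (fun=> 0).
  by have [x ?] := @delta_star_attained R V m E blk k (U2_observable kU); exists x.
have d0 k : k \in U2 -> 0 < delta k by move=> kU; rewrite (lt_le_trans ltr01)// delta_ge1.
exists (fun v => if blk v \in U2 then G * ln #|block (blk v)|%:R * x (blk v) v else 0).
exists (fun v => h / delta (blk v) * x (blk v) v).
split.
- move=> v; case: ifP => // kU; have [x01 _ _] := hx _ kU.
  have /andP[x0 _] := x01 v.
  by rewrite !mulr_ge0 ?(ltW G0) ?(ltW (ln_block_gt0 kU)).
- rewrite (sum_blocks blk) mulr_sumr [RHS]big_mkcond/=; apply: eq_bigr => k _.
  case: ifPn => kU; last first.
    by apply: big1 => v; rewrite mem_block => /eqP ->; rewrite (negPf kU).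
  have [_ _ <-] := hx _ kU; rewrite mulrA mulrAC mulr_sumr; apply: eq_bigr => v.
  by rewrite mem_block => /eqP ->; rewrite kU.
- by move=> v /negPf ->.
move=> k kU; have [x01 xO xd] := hx _ kU; split.
- move=> v; rewrite mem_block => /eqP ->; have /andP[x0 _] := x01 v.
  by rewrite mulr_ge0// divr_ge0 ?(ltW h0) ?(ltW (d0 k kU)).
- rewrite (eq_bigr (fun v => h / delta k * x k v)); last first.
    by move=> v; rewrite mem_block => /eqP ->.
  by rewrite -mulr_sumr xd divfK// gt_eqF// d0.
- move=> v vb; rewrite (eq_bigr (fun u => h / delta k * x k u)); last first.
    by move=> u; rewrite inE => /andP[_]; rewrite mem_block => /eqP ->.
  rewrite -mulr_sumr -[leLHS]mulr1 ler_pM2l ?divr_gt0 ?d0//; exact: xO.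
- move=> v vb; rewrite (eq_bigr (fun u => G * ln #|block k|%:R * x k u)); last first.
    by move=> u; rewrite inE => /andP[_]; rewrite mem_block => /eqP ->; rewrite kU.
  rewrite -mulr_sumr -[leLHS]mulr1 ler_pM2l ?mulr_gt0 ?ln_block_gt0//; exact: xO.
Qed.

Lemma le_sum_term (A : {set V}) (f : V -> R) v : v \in A ->
  (forall u, u \in A -> 0 <= f u) -> f v <= \sum_(u in A) f u.
Proof.
move=> vA f0; rewrite (bigD1 v)//= lerDl; apply: sumr_ge0 => u /andP[uA _].
exact: f0.
Qed.

Lemma sum_setC1 (f : V -> R) v : \sum_(u in [set~ v]) f u = \sum_u f u - f v.
Proof.
by rewrite [in RHS](bigD1 v)//= [RHS]addrAC subrr add0r; apply: eq_bigl => u; rewrite !inE.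
Qed.

(* With [tau = T ^ (1 / 3)], the exploration factors are tuned so that the three
   contributions of order [K * w * tau ^ 2] and the three contributions of order
   [d * tau ^ 2 / c] balance. *)
Lemma regret_U2 (T : nat) (tau K c d w eS eN : R) :
    U2 != finset.set0 -> 0 < tau -> T%:R = tau ^+ 3 ->
    0 < K -> 0 < c -> c ^+ 3 = 2 -> 0 < d -> d ^+ 3 = Dlog ->
    0 < w -> w ^+ 3 = Num.sqrt #|U2|%:R * Num.sqrt D2 -> 0 < eS -> 0 < eN ->
    4 + 8 * nu <= K ^+ 3 -> 2 * d <= c * tau -> K * w < tau ->
    (U1NS != finset.set0 ->
      [/\ 4 * (Num.sqrt #|U2|%:R / (K * w * tau ^+ 2)) <= d / (c * tau),
          4 * eS <= d / (c * tau) & 2 * eN <= d / (c * tau)]) ->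
  exists2 p : params R V m, valid_params s blk p &
  forall ell : nat -> V -> R,
    (forall (t : nat) (v : V), (t < T)%N -> 0 <= ell t v <= 1) ->
  forall a : V, regret E s blk p ell T a
    <= 3 * (K * w * tau ^+ 2) + 3 * (d * tau ^+ 2 / c)
      + Num.sqrt #|U1S|%:R / eS + ln (#|U1NS|%:R + 1) / eN
      + T%:R * (4 * eS * Num.sqrt #|U1S|%:R
          + nu * (8 * eS * Num.sqrt #|U1S|%:R + 5 * eN)).
Proof.
move=> U0 t0 TE K0 c0 c3 d0 d3 w0 w3 eS0 eN0 K3 dc Kw expl.
(* Over [T] rounds the global exploration then costs [d * tau ^+ 2 / c] and the local one
   [K * w * tau ^+ 2]. The rates [e] and [el] below make the initial divergences cost these same
   amounts. *)
pose G := (c * tau * d ^+ 2)^-1; pose h := K * w / tau.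
have G0 : 0 < G by rewrite invr_gt0 !mulr_gt0// exprn_gt0.
have h0 : 0 < h by rewrite divr_gt0// mulr_gt0.
have h1 : h < 1 by rewrite ltr_pdivrMr// mul1r.
have [g [gl [g0 gsum gU glk]]] := exists_exploration G0 h0.
have gbarE : \sum_v g v = d / (c * tau).
  by rewrite gsum -d3 /G; field; rewrite !gt_eqF.
have gbar2 : \sum_v g v <= 2^-1.
  by rewrite gbarE ler_pdivrMr ?mulr_gt0//; lra.
have u2_0 : 0 < Num.sqrt #|U2|%:R :> R by rewrite sqrtr_gt0 ltr0n card_gt0.
pose e := Num.sqrt #|U2|%:R / (K * w * tau ^+ 2).
have e0 : 0 < e by rewrite divr_gt0// !mulr_gt0// exprn_gt0.
pose el k : R := ln #|block k|%:R * (c / (d * tau ^+ 2)).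
have el0 k : k \in U2 -> 0 < el k.
  by move=> kU; rewrite mulr_gt0 ?ln_block_gt0// divr_gt0// mulr_gt0// exprn_gt0.
pose p := @Params R V m e eS eN el (fun=> g) (fun=> gl).
have g1 v : g v <= \sum_u g u.
  by rewrite (bigD1 v)//= lerDl; apply: sumr_ge0.
exists p.
  split=> //= [t|t k kU].
    split=> [v|]; last by lra.
    by rewrite g0; have := g1 v; lra.
  have [gl0 gls _ _] := glk k kU; split=> [v vb|]; last by rewrite gls ltW.
  by rewrite gl0//= (le_trans (le_sum_term vb gl0))// gls ltW.
move=> ell ell01 a.
have := @regret_bound R V m s E blk p g gl (fun k => h / delta k)
  (fun k => G * ln #|block k|%:R) ell T a (1 - \sum_v g v)^-1 legal.
set b := (1 - _)^-1 => /(_ _ el0 (fun=> erefl) (fun=> erefl) g0) rb.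
have {rb} := rb _ _ _ _ _ _ ell01 erefl.
have -> : \sum_(k in U2) (h / delta k)^-1 ^+ 2 = D2 / h ^+ 2.
  rewrite mulr_suml; apply: eq_bigr => k kU.
  have dk := lt_le_trans ltr01 (delta_ge1 kU).
  by field; rewrite !gt_eqF.
rewrite sqrtrM; last by apply: sumr_ge0 => k _; exact: sqr_ge0.
rewrite sqrtrV ?exprn_ge0 ?(ltW h0)// sqrtr_sqr gtr0_norm//= -/e.
move=> rb; apply: le_trans (rb _ _ _ _ _ _) _ => {rb}.
- by [].
- by lra.
- by move=> k kU; have [? -> _ _] := glk k kU.
- move=> k kU; have [_ _ ? _] := glk k kU; split=> //.
  by rewrite divr_gt0// (lt_le_trans ltr01)// delta_ge1.
- by move=> k kU; have [_ _ _ ?] := glk k kU; split=> //; rewrite mulr_gt0 ?ln_block_gt0.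
- move=> v vN; rewrite sum_setC1 gU ?subr0 ?gbarE; last first.
    by move: vN; rewrite in_U1NS => /andP[].
  by apply: expl; apply/set0Pn; exists (blk v).
have b0 : 0 < b by rewrite invr_gt0; lra.
have b2 : b <= 2 by rewrite -[leRHS]invrK lef_pV2 ?posrE; lra.
have T0 : 0 < T%:R :> R by rewrite TE exprn_gt0.
have loc1 : (if blk a \in U2 then ln #|block (blk a)|%:R / el (blk a) else 0)
    <= d * tau ^+ 2 / c.
  case: ifP => kU; last by rewrite divr_ge0 ?mulr_ge0 ?exprn_ge0 ?(ltW d0) ?(ltW c0) ?(ltW t0).
  rewrite /el le_eqVlt; apply/orP; left; apply/eqP; field.
  by rewrite !gt_eqF// ln_block_gt0.
have loc2 : (if blk a \in U2 then \sum_(v in block (blk a)) gl v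
      + el (blk a) / (2 * (G * ln #|block (blk a)|%:R)) else 0) <= h + d / (c * tau).
  case: ifP => kU; last by rewrite addr_ge0 ?(ltW h0)// divr_ge0 ?mulr_ge0 ?(ltW d0) ?(ltW c0) ?(ltW t0).
  have [_ -> _ _] := glk _ kU; rewrite lerD2l le_eqVlt; apply/orP; left; apply/eqP.
  (* Here [c ^+ 3 = 2] absorbs the 2 of [el / (2 * gk)], which makes this term equal to the total
     global exploration. *)
  have -> : d / (c * tau) = d * c ^+ 2 / (c ^+ 3 * tau) by field; rewrite !gt_eqF.
  by rewrite c3 /el /G; field; rewrite !gt_eqF// ln_block_gt0.
have D20 : 0 < Num.sqrt D2.
  by rewrite sqrtr_gt0 (lt_le_trans _ card_U2_le_D2)// ltr0n card_gt0.
set X := e * (Num.sqrt D2 / h).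
have TX : T%:R * X = w * tau ^+ 2 / K ^+ 2.
  have -> : T%:R * X = (Num.sqrt #|U2|%:R * Num.sqrt D2) * tau ^+ 2 / (K ^+ 2 * w ^+ 2).
    by rewrite TE /X /e /h; field; rewrite !gt_eqF.
  by rewrite -w3; field; rewrite !gt_eqF.
have X0 : 0 < X by rewrite mulr_gt0// divr_gt0.
(* The contribution of the shift on [U2] is dominated by the main stability term, since [h < 1] and
   every [delta k] is at least 1. *)
have uX : e * Num.sqrt #|U2|%:R <= X.
  rewrite ler_pM2l// ler_pdivlMr//.
  apply: (@le_trans _ _ (Num.sqrt #|U2|%:R)); first by rewrite ler_piMr// ltW.
  by rewrite ler_wsqrtr// card_U2_le_D2.
(* The 4 and the 8 are [2 * b] and [4 * b] with [b <= 2]; this is what fixes the size of [K]. *)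
have KX : (4 + 8 * nu) * (T%:R * X) <= K * w * tau ^+ 2.
  rewrite TX; have -> : K * w * tau ^+ 2 = K ^+ 3 * (w * tau ^+ 2 / K ^+ 2).
    by field; rewrite gt_eqF.
  by rewrite ler_wpM2r// divr_ge0 ?mulr_ge0 ?exprn_ge0 ?ltW.
have q1 : Num.sqrt #|U2|%:R / e = K * w * tau ^+ 2.
  by rewrite /e; field; rewrite !gt_eqF.
have q2 : T%:R * (d / (c * tau)) = d * tau ^+ 2 / c.
  by rewrite TE; field; rewrite !gt_eqF.
have q3 : T%:R * h = K * w * tau ^+ 2 by rewrite TE /h; field; rewrite !gt_eqF.
rewrite q1 gbarE.
have uS0 : 0 <= Num.sqrt #|U1S|%:R :> R by rewrite sqrtr_ge0.
have nu0 : 0 <= nu by [].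
have stabB : 2 * e * b * (Num.sqrt D2 / h) + 2 * eS * b * Num.sqrt #|U1S|%:R +
    nu * (4 * e * b * Num.sqrt #|U2|%:R + 4 * eS * b * Num.sqrt #|U1S|%:R
      + (eN + 2 * eN * b))
    <= (4 + 8 * nu) * X + (4 * eS * Num.sqrt #|U1S|%:R
          + nu * (8 * eS * Num.sqrt #|U1S|%:R + 5 * eN)).
  have s1 : b * X <= 2 * X by rewrite ler_pM2r.
  have s2 : b * (eS * Num.sqrt #|U1S|%:R) <= 2 * (eS * Num.sqrt #|U1S|%:R).
    by rewrite ler_wpM2r// mulr_ge0// ltW.
  have s3 : nu * (4 * (b * (e * Num.sqrt #|U2|%:R))
      + 4 * (b * (eS * Num.sqrt #|U1S|%:R)) + (eN + 2 * (b * eN)))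
      <= nu * (4 * (2 * X) + 4 * (2 * (eS * Num.sqrt #|U1S|%:R)) + (eN + 2 * (2 * eN))).
    rewrite ler_wpM2l//.
    have : b * (e * Num.sqrt #|U2|%:R) <= b * X by rewrite ler_pM2l.
    have : b * eN <= 2 * eN by rewrite ler_pM2r.
    lra.
  rewrite /X in s1 s3 *; lra.
apply: (@le_trans _ _ (K * w * tau ^+ 2 + Num.sqrt #|U1S|%:R / eS
   + ln (#|U1NS|%:R + 1) / eN + d * tau ^+ 2 / c
   + T%:R * (d / (c * tau) + (h + d / (c * tau)) + ((4 + 8 * nu) * X
     + (4 * eS * Num.sqrt #|U1S|%:R
          + nu * (8 * eS * Num.sqrt #|U1S|%:R + 5 * eN)))))).
  by apply: lerD; [rewrite lerD2l|rewrite ler_pM2l// lerD// lerD2l].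
lra.
Qed.

End Tuning.

(** * Fractional powers of the horizon *)

Section Powers.
Context {R : realType}.
Implicit Types x : R.

Lemma powR_frac x (p q : R) (n : nat) : 0 <= x -> p = q * n%:R ->
  x `^ p = (x `^ q) ^+ n.
Proof. by move=> x0 ->; rewrite powRrM powR_mulrn// powR_ge0. Qed.

(** The exponents 1/2, 2/3 and 1 are multiples of 1/6, so every condition that [T] be large is put
    on its sixth root. *)
Lemma eventually_le_root (M : R) : exists T0 : nat, forall T : nat, (T0 <= T)%N ->
  M <= T%:R `^ (1 / 6).
Proof.
have [M0|M0] := lerP M 0.
  by exists 0%N => T _; apply: le_trans M0 (powR_ge0 _ _).
exists (Num.bound (M ^+ 6)) => T hT.
have M6 : 0 <= M ^+ 6 by rewrite exprn_ge0// ltW.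
have -> : M = (M ^+ 6) `^ (1 / 6).
  rewrite -powR_mulrn ?(ltW M0)// -powRrM.
  have -> : 6%:R * (1 / 6) = 1 :> R by field.
  by rewrite powRr1// ltW.
apply: ge0_ler_powR; rewrite ?nnegrE//.
apply: le_trans (ltW (archi_boundP M6)) _.
by rewrite ler_nat.
Qed.

End Powers.

(** * The four cases of the bound *)

Section Cases.
Context {R : realType} {V : finType} {m : nat}.
Variables (E : rel V) (s : nat) (blk : V -> 'I_m).
Hypothesis legal : legal_partition E s blk.

Local Notation U2 := (@U2 m s).
Local Notation U1S := (U1S E s blk).
Local Notation U1NS := (U1NS E s blk).
Local Notation block := (block blk).
Local Notation delta := (delta_star E blk R).
Local Notation u2 := (#|U2|%:R : R).
Local Notation u1S := (#|U1S|%:R : R).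
Local Notation u1NS := (#|U1NS|%:R : R).
Local Notation D2 := (\sum_(k in U2) delta k ^+ 2).
Local Notation Dlog := (\sum_(k in U2) delta k * ln (#|block k|%:R)).

Definition tuned (T : nat) (B : R) : Prop :=
  exists2 p : params R V m, valid_params s blk p &
  forall ell : nat -> V -> R,
    (forall (t : nat) (v : V), (t < T)%N -> 0 <= ell t v <= 1) ->
  forall a : V, regret E s blk p ell T a <= B.

Lemma tuned_loops (T : nat) : (0 < T)%N -> U2 = finset.set0 -> U1NS = finset.set0 ->
  tuned T (2 * Num.sqrt (2 * u1S) * T%:R `^ (1 / 2)).
Proof.
move=> T0 U20 N0.
have k2 k : k \notin U2 by rewrite U20 inE.
have {}T0 : 0 < T%:R :> R by rewrite ltr0n.
rewrite div1r powR12_sqrt ?(ltW T0)//.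
have st : 0 < Num.sqrt T%:R :> R by rewrite sqrtr_gt0.
have s2 : 0 < Num.sqrt 2 :> R by rewrite sqrtr_gt0.
(* With no exploration [b] is 1, and this rate equates the initial divergence with the total
   stability cost. *)
pose e : R := (Num.sqrt 2 * Num.sqrt T%:R)^-1.
have e0 : 0 < e by rewrite invr_gt0 mulr_gt0.
pose z : V -> R := fun=> 0.
have zsum (A : {set V}) : \sum_(v in A) z v = 0 by rewrite big1.
have zsumT : \sum_v z v = 0 by rewrite big1.
pose p := @Params R V m 1 e 1 (fun=> 1) (fun=> z) (fun=> z).
exists p.
  split=> //= [t|t k]; last by rewrite (negPf (k2 k)).
  by rewrite zsumT; split=> // v; rewrite /z lexx ler01.
move=> ell ell01 a.
have := @regret_bound R V m s E blk p z z (fun=> 1) (fun=> 1) ell T a 1 legal.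
move=> /(_ _ _ (fun=> erefl) (fun=> erefl)) rb.
apply: le_trans (rb _ _ _ _ _ _ _ _ ell01 _) _ => //.
- by rewrite zsumT.
- by move=> k; rewrite (negPf (k2 k)).
- by move=> k; rewrite (negPf (k2 k)).
- by move=> k; rewrite (negPf (k2 k)).
- by move=> v; rewrite N0 inE.
- by rewrite zsumT subr0 invr1.
rewrite (negPf (k2 _)) zsumT N0 eqxx U20 big_set0 !cards0 /= sqrtr0 add0r ln1.
have c2 : Num.sqrt 2 * Num.sqrt 2 = 2 :> R by rewrite -expr2 sqr_sqrtr.
have r1 : Num.sqrt u1S / e = Num.sqrt 2 * (Num.sqrt u1S * Num.sqrt T%:R).
  by rewrite /e invrK; ring.
have r2 : 2 * (T%:R * (e * Num.sqrt u1S)) = Num.sqrt 2 * (Num.sqrt u1S * Num.sqrt T%:R).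
  have := sqr_sqrtr (ltW T0); rewrite -{1}c2 /e; set S := Num.sqrt T%:R => <-.
  by field; rewrite !gt_eqF.
rewrite sqrtrM// r1; lra.
Qed.

Lemma card_gt1_U1NS v : blk v \in U1NS -> (1 < #|V|)%N.
Proof.
move=> vN; case: legal => obs _ _ _ _.
have /set0Pn[u] := obs v (finset.in_setT v).
rewrite finset.setIT (U1NS_Nin legal vN (block_blk blk v)) !inE => uv.
by apply/card_gt1P; exists u, v.
Qed.

(** The coefficient of [sqrt u1S * sqrt T] will be [8 + 12 / 8 = 19 / 2], to be compared with
    [4 * sqrt 6]. *)
Lemma sqrt6_ge : 19 / 8 <= Num.sqrt 6 :> R.
Proof.
have -> : 19 / 8 = Num.sqrt ((19 / 8) ^+ 2) :> R by rewrite sqrtr_sqr gtr0_norm.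
by rewrite ler_sqrt//; lra.
Qed.

Lemma tuned_strong : U2 = finset.set0 -> U1NS != finset.set0 ->
  exists T0 : nat, forall T : nat, (T0 <= T)%N ->
  tuned T (4 * Num.sqrt (6 * u1S) * T%:R `^ (1 / 2)
           + 2 * Num.sqrt (10 * ln (u1NS + 1)) * T%:R `^ (1 / 2)
           + T%:R `^ (1 / 2)).
Proof.
move=> U20 N0.
have k2 k : k \notin U2 by rewrite U20 inE.
have n0 : 0 < ln (u1NS + 1) by rewrite ln_gt0// ltrDr ltr0n card_gt0.
(* The target term becomes [20 * lam * sqrt T]; divergence, exploration and stability contribute 10,
   4 and 5. *)
pose lam := Num.sqrt (ln (u1NS + 1) / 10).
have l0 : 0 < lam by rewrite sqrtr_gt0 divr_gt0.
have l2 : ln (u1NS + 1) = 10 * lam ^+ 2.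
  by rewrite sqr_sqrtr ?divr_ge0 ?(ltW n0)//; field.
have [T0 hT0] := eventually_le_root (1 + 2 * (4 * lam + 1)).
exists T0 => T /hT0 hT.
set ka := T%:R `^ (1 / 6) in hT.
have TE : T%:R = ka ^+ 6 :> R.
  by rewrite -(@powR_frac _ _ 1) ?powRr1//; field.
have T12 : T%:R `^ (1 / 2) = ka ^+ 3 by apply: powR_frac => //; field.
rewrite T12; set S := ka ^+ 3.
have TS : T%:R = S ^+ 2 by rewrite TE -exprM.
have ka1 : 1 <= ka by lra.
have kS : ka <= S by rewrite /S exprS ler_peMr ?(le_trans ler01)// exprn_ege1.
have S0 : 0 < S by lra.
have /set0Pn[k0 k0N] := N0.
have /set0Pn[v0 v0b] := block_neq0 legal k0.
have v0N : blk v0 \in U1NS by move: v0b; rewrite mem_block => /eqP ->.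
have V2 : (1 < #|V|)%N := card_gt1_U1NS v0N.
have V2' : 2 <= #|V|%:R :> R by rewrite ler_nat.
(* The exploration is uniform on at least two vertices, so half of [gam0] lies outside any given
   one, and [gam0 / 2 = 4 * eS + 2 * eN] covers [explore_others]. *)
pose gam0 := (4 * lam + 1) / S.
have gam0_gt0 : 0 < gam0 by rewrite divr_gt0//; lra.
have gam0_le : gam0 <= 2^-1 by rewrite ler_pdivrMr//; lra.
pose g : V -> R := fun=> gam0 / #|V|%:R.
pose z : V -> R := fun=> 0.
have Vn : #|V|%:R != 0 :> R by rewrite gt_eqF//; lra.
have g0 v : 0 < g v by rewrite divr_gt0//; lra.
have gsum : \sum_v g v = gam0.
  by rewrite /g /= sumr_const -[LHS]mulr_natr divfK.
have gle v : g v <= gam0 / 2.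
  by rewrite ler_pM2l// lef_pV2 ?posrE//; lra.
have gothers v : gam0 / 2 <= \sum_(u in [set~ v]) g u.
  by rewrite sum_setC1 gsum; have := gle v; lra.
pose eS := (8 * S)^-1; pose eN := lam / S.
have eS0 : 0 < eS by rewrite invr_gt0 mulr_gt0.
have eN0 : 0 < eN by rewrite divr_gt0.
pose p := @Params R V m eS eS eN (fun=> 1) (fun=> g) (fun=> z).
exists p.
  split=> //= [t|t k]; last by rewrite (negPf (k2 k)).
  split; last by rewrite gsum; lra.
  by move=> v; rewrite (ltW (g0 v))/=; have := gle v; lra.
move=> ell ell01 a.
have := @regret_bound R V m s E blk p g z (fun=> 1) (fun=> 1) ell T a _ legal.
move=> /(_ _ _ _ (fun=> erefl) (fun=> erefl)) rb.
apply: le_trans (rb _ _ _ _ _ _ _ _ _ ell01 erefl) _ => // {rb}.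
- by move=> v; exact: ltW.
- by rewrite gsum; lra.
- by move=> k; rewrite (negPf (k2 k)).
- by move=> k; rewrite (negPf (k2 k)).
- by move=> k; rewrite (negPf (k2 k)).
- move=> v _ /=; have := gothers v.
  have e1 : gam0 / 2 = 4 * eS + 2 * eN by rewrite /gam0 /eS /eN; field; rewrite gt_eqF.
  by split; lra.
rewrite (negPf (k2 _)) gsum U20 big_set0 !cards0 /= sqrtr0 N0 mul0r !mulr0 !addr0 !add0r mul1r.
set b := (1 - gam0)^-1.
have b0 : 0 < b by rewrite invr_gt0; lra.
have b2 : b <= 2 by rewrite -[leRHS]invrK lef_pV2 ?posrE; lra.
have -> : 10 * ln (u1NS + 1) = (10 * lam) ^+ 2 by rewrite l2; ring.
rewrite sqrtr_sqr gtr0_norm ?mulr_gt0// sqrtrM// l2.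
have := sqrtr_ge0 u1S; set q := Num.sqrt u1S => q0.
have s6 : 19 / 8 * (q * S) <= Num.sqrt 6 * (q * S).
  by rewrite ler_wpM2r ?sqrt6_ge// mulr_ge0// ltW.
have r1 : q / eS = 8 * (q * S) by rewrite /eS invrK; ring.
have r2 : 10 * lam ^+ 2 / eN = 10 * (lam * S).
  by rewrite /eN; field; rewrite !gt_eqF.
have r3 : T%:R * gam0 = 4 * (lam * S) + S by rewrite TS /gam0; field; rewrite gt_eqF.
have r4 : T%:R * eN = lam * S by rewrite TS /eN; field; rewrite gt_eqF.
have r5 : 8 * (T%:R * eS) = S by rewrite TS /eS; field; rewrite gt_eqF.
have r6 : b * (T%:R * eS * q) <= 2 * (T%:R * eS * q).
  by rewrite ler_wpM2r// mulr_ge0// mulr_ge0// ltW.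
have r7 : b * (T%:R * eN) <= 2 * (T%:R * eN).
  by rewrite ler_wpM2r// mulr_ge0// ltW.
have r8 : 8 * (T%:R * eS * q) = q * S by rewrite -[in RHS]r5; ring.
have lS : 0 < lam * S by rewrite mulr_gt0.
rewrite r1 r2; lra.
Qed.

Lemma tuned_U2 : U2 != finset.set0 -> U1NS = finset.set0 ->
  exists T0 : nat, forall T : nat, (T0 <= T)%N ->
  tuned T (3 * 2 `^ (2 / 3) * (u2 * D2) `^ (1 / 6) * T%:R `^ (2 / 3)
              + 3 / 2 `^ (1 / 3) * Dlog `^ (1 / 3) * T%:R `^ (2 / 3)
              + 4 * Num.sqrt u1S * T%:R `^ (1 / 2)).
Proof.
move=> U20 N0.
have u0 : 0 < u2 by rewrite ltr0n card_gt0.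
have D20 : 0 < D2 := lt_le_trans u0 (@card_U2_le_D2 R V m E s blk legal).
have DL0 := @Dlog_gt0 R V m E s blk legal U20.
set c := 2 `^ (1 / 3); set d := Dlog `^ (1 / 3); set w := (u2 * D2) `^ (1 / 6).
(* [K ^+ 3 = 4] is the least value allowed by [regret_U2] when [nu = 0]. *)
set K := 2 `^ (2 / 3).
have c0 : 0 < c by rewrite powR_gt0.
have d0 : 0 < d by rewrite powR_gt0.
have w0 : 0 < w by rewrite powR_gt0// mulr_gt0.
have K0 : 0 < K by rewrite powR_gt0.
have c3 : c ^+ 3 = 2 by rewrite -(@powR_frac _ _ 1) ?powRr1//; field.
have KE : K = c ^+ 2 by apply: powR_frac => //; field.
have K3 : K ^+ 3 = 4 by rewrite KE -exprM mulnC exprM c3; ring.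
have d3 : d ^+ 3 = Dlog.
  by rewrite -(@powR_frac _ _ 1) ?powRr1 ?(ltW DL0)//; field.
have w3 : w ^+ 3 = Num.sqrt u2 * Num.sqrt D2.
  have uD : 0 <= u2 * D2 by rewrite mulr_ge0 ?(ltW u0) ?(ltW D20).
  rewrite -sqrtrM ?(ltW u0)// -powR12_sqrt//.
  by rewrite (@powR_frac _ _ 2^-1 (1 / 6) 3 uD)//; field.
have M1 : 0 < 2 * d / c by rewrite divr_gt0// mulr_gt0.
have M2 : 0 < K * w by rewrite mulr_gt0.
have [T0 hT0] := eventually_le_root (1 + 2 * d / c + K * w).
exists T0 => T /hT0 hT.
set ka := T%:R `^ (1 / 6) in hT.
have ka1 : 1 < ka by lra.
have ka0 : 0 < ka by lra.
have TE : T%:R = (ka ^+ 2) ^+ 3 :> R.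
  by rewrite -exprM -(@powR_frac _ _ 1) ?powRr1//; field.
have -> : T%:R `^ (1 / 2) = ka ^+ 3 by apply: powR_frac => //; field.
have -> : T%:R `^ (2 / 3) = (ka ^+ 2) ^+ 2.
  by rewrite -exprM; apply: powR_frac => //; field.
have kk : ka <= ka ^+ 2 by rewrite expr2 ler_peMr// ltW.
pose eS := (2 * ka ^+ 3)^-1.
have eS0 : 0 < eS by rewrite invr_gt0 mulr_gt0// exprn_gt0.
have [||||p pv rb] := @regret_U2 R V m E s blk legal T (ka ^+ 2) K c d w eS 1
  U20 (exprn_gt0 _ ka0) TE K0 c0 c3 d0 d3 w0 w3 eS0 ltr01.
- by rewrite N0 eqxx/= mulr0 addr0 K3.
- by rewrite [leRHS]mulrC -ler_pdivrMr//; lra.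
- by lra.
- by rewrite N0 eqxx.
exists p => // ell ell01 a; apply: le_trans (rb ell ell01 a) _.
rewrite N0 eqxx cards0 add0r ln1 mul0r mul0r !addr0.
have r1 : Num.sqrt u1S / eS = 2 * Num.sqrt u1S * ka ^+ 3 by rewrite /eS invrK; ring.
have r2 : T%:R * (4 * eS * Num.sqrt u1S) = 2 * Num.sqrt u1S * ka ^+ 3.
  by rewrite TE /eS; field; rewrite gt_eqF.
rewrite r1 r2 le_eqVlt; apply/orP; left; apply/eqP; field.
by rewrite gt_eqF.
Qed.

(** The global exploration of [U2], of order [T ^ (- 1 / 3)], lies outside every vertex without
    self-loop and for large [T] dominates the rates, of order [T ^ (- 2 / 3)] and [T ^ (- 1 / 2)];
    it therefore also provides [explore_others]. *)
Lemma tuned_U2_strong : U2 != finset.set0 -> U1NS != finset.set0 ->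
  exists T0 : nat, forall T : nat, (T0 <= T)%N ->
  tuned T (6 * 2 `^ (1 / 3) * (u2 * D2) `^ (1 / 6) * T%:R `^ (2 / 3)
              + 3 / 2 `^ (1 / 3) * Dlog `^ (1 / 3) * T%:R `^ (2 / 3)
              + 4 * Num.sqrt (6 * u1S) * T%:R `^ (1 / 2)
              + 2 * Num.sqrt (10 * ln (u1NS + 1)) * T%:R `^ (1 / 2)).
Proof.
move=> U20 N0.
have u0 : 0 < u2 by rewrite ltr0n card_gt0.
have D20 : 0 < D2 := lt_le_trans u0 (@card_U2_le_D2 R V m E s blk legal).
have DL0 := @Dlog_gt0 R V m E s blk legal U20.
set c := 2 `^ (1 / 3); set d := Dlog `^ (1 / 3); set w := (u2 * D2) `^ (1 / 6).
(* [3 * K] is the leading coefficient of the goal; [K ^+ 3 = 16] exceeds the required 12. *)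
pose K := 2 * c.
have c0 : 0 < c by rewrite powR_gt0.
have d0 : 0 < d by rewrite powR_gt0.
have w0 : 0 < w by rewrite powR_gt0// mulr_gt0.
have K0 : 0 < K by rewrite mulr_gt0.
have c3 : c ^+ 3 = 2 by rewrite -(@powR_frac _ _ 1) ?powRr1//; field.
have K3 : K ^+ 3 = 16 by rewrite /K exprMn c3; ring.
have d3 : d ^+ 3 = Dlog.
  by rewrite -(@powR_frac _ _ 1) ?powRr1 ?(ltW DL0)//; field.
have w3 : w ^+ 3 = Num.sqrt u2 * Num.sqrt D2.
  have uD : 0 <= u2 * D2 by rewrite mulr_ge0 ?(ltW u0) ?(ltW D20).
  rewrite -sqrtrM ?(ltW u0)// -powR12_sqrt//.
  by rewrite (@powR_frac _ _ 2^-1 (1 / 6) 3 uD)//; field.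
have n0 : 0 < ln (u1NS + 1) by rewrite ln_gt0// ltrDr ltr0n card_gt0.
pose lam := Num.sqrt (ln (u1NS + 1) / 10).
have l0 : 0 < lam by rewrite sqrtr_gt0 divr_gt0.
have l2 : ln (u1NS + 1) = 10 * lam ^+ 2.
  by rewrite sqr_sqrtr ?divr_ge0 ?(ltW n0)//; field.
have su0 : 0 < Num.sqrt u2 by rewrite sqrtr_gt0.
pose M3 := 4 * Num.sqrt u2 / (K * w) * c / d.
pose M4 := 2^-1 * c / d; pose M5 := 2 * lam * c / d.
have M1 : 0 < 2 * d / c by rewrite divr_gt0// mulr_gt0.
have M2 : 0 < K * w by rewrite mulr_gt0.
have M30 : 0 < M3 by rewrite !(divr_gt0, mulr_gt0).
have M40 : 0 < M4 by rewrite !(divr_gt0, mulr_gt0).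
have M50 : 0 < M5 by rewrite !(divr_gt0, mulr_gt0).
have [T0 hT0] := eventually_le_root (1 + 2 * d / c + K * w + M3 + M4 + M5).
exists T0 => T /hT0 hT.
set ka := T%:R `^ (1 / 6) in hT.
have ka1 : 1 < ka by lra.
have ka0 : 0 < ka by lra.
have TE : T%:R = (ka ^+ 2) ^+ 3 :> R.
  by rewrite -exprM -(@powR_frac _ _ 1) ?powRr1//; field.
have -> : T%:R `^ (1 / 2) = ka ^+ 3 by apply: powR_frac => //; field.
have -> : T%:R `^ (2 / 3) = (ka ^+ 2) ^+ 2.
  by rewrite -exprM; apply: powR_frac => //; field.
have kk : ka <= ka ^+ 2 by rewrite expr2 ler_peMr// ltW.
set S := ka ^+ 3; have S0 : 0 < S by rewrite exprn_gt0.
(* The two sides of the conclusion have ratio [(A * c / d) / ka]; [M3], [M4] and [M5] are the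
   resulting thresholds for [4 * eta], [4 * eta_S] and [2 * eta_NS]. *)
have small A : 0 < A -> A * c / d <= ka -> A / S <= d / (c * ka ^+ 2).
  move=> A0 hA.
  have -> : A / S = (A * c / d) * (d / (c * S)) by field; rewrite !gt_eqF.
  have -> : d / (c * ka ^+ 2) = ka * (d / (c * S)) by rewrite /S; field; rewrite !gt_eqF.
  by rewrite ler_wpM2r// divr_ge0 ?mulr_ge0 ?ltW.
pose eS := (8 * S)^-1; pose eN := lam / S.
have eS0 : 0 < eS by rewrite invr_gt0 mulr_gt0.
have eN0 : 0 < eN by rewrite divr_gt0.
have [||||p pv rb] := @regret_U2 R V m E s blk legal T (ka ^+ 2) K c d w eS eN
  U20 (exprn_gt0 _ ka0) TE K0 c0 c3 d0 d3 w0 w3 eS0 eN0.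
- by rewrite N0/= K3; lra.
- by rewrite [leRHS]mulrC -ler_pdivrMr//; lra.
- by lra.
- move=> _; split.
  + apply: le_trans (small (4 * Num.sqrt u2 / (K * w)) _ _); last first.
    * by rewrite -/M3; lra.
    * by rewrite divr_gt0// mulr_gt0.
    rewrite mulrA invfM mulrA ler_wpM2l//; first by rewrite divr_ge0 ?mulr_ge0 ?ltW.
    rewrite lef_pV2 ?posrE ?exprn_gt0// /S -exprM.
    by rewrite ler_weXn2l// ltW.
  + have -> : 4 * eS = 2^-1 / S by rewrite /eS; field; rewrite gt_eqF.
    by apply: small => //; rewrite -/M4; lra.
  + have -> : 2 * eN = 2 * lam / S by rewrite /eN mulrA.
    by apply: small; rewrite ?mulr_gt0// -/M5; lra.
exists p => // ell ell01 a; apply: le_trans (rb ell ell01 a) _.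
rewrite N0 mul1r.
have -> : 10 * ln (u1NS + 1) = (10 * lam) ^+ 2 by rewrite l2; ring.
rewrite sqrtr_sqr gtr0_norm ?mulr_gt0// sqrtrM// l2.
have := sqrtr_ge0 u1S; set q := Num.sqrt u1S => q0.
have s6 : 19 / 8 * (q * S) <= Num.sqrt 6 * (q * S).
  by rewrite ler_wpM2r ?sqrt6_ge// mulr_ge0// ltW.
have TS : T%:R = S ^+ 2 :> R by rewrite TE /S -!exprM.
have r1 : q / eS = 8 * (q * S) by rewrite /eS invrK; ring.
have r2 : 10 * lam ^+ 2 / eN = 10 * (lam * S).
  by rewrite /eN; field; rewrite !gt_eqF.
have r4 : T%:R * eN = lam * S by rewrite TS /eN; field; rewrite gt_eqF.
have r8 : 8 * (T%:R * eS * q) = q * S by rewrite TS /eS; field; rewrite gt_eqF.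
have lS : 0 < lam * S by rewrite mulr_gt0.
have qS : 0 <= q * S by rewrite mulr_ge0// ltW.
rewrite r1 r2.
have -> : T%:R * (4 * eS * q + (8 * eS * q + 5 * eN))
  = 12 * (T%:R * eS * q) + 5 * (T%:R * eN) by ring.
rewrite r4 /K.
have -> : 3 * (d * (ka ^+ 2) ^+ 2 / c) = 3 / c * d * (ka ^+ 2) ^+ 2 by ring.
lra.
Qed.

End Cases.

Theorem theorem12 (R : realType) (V : finType) (E : rel V)
    (m s : nat) (blk : V -> 'I_m) (legal : legal_partition E s blk) :
  let U2 := @U2 m s in
  let U1S := U1S E s blk in
  let U1NS := U1NS E s blk in
  let delta := delta_star E blk R in
  let u2 : R := #|U2|%:R in
  let u1S : R := #|U1S|%:R in
  let u1NS : R := #|U1NS|%:R in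
  let D2 := \sum_(k in U2) delta k ^+ 2 in
  let Dlog := \sum_(k in U2) delta k * ln (#|block blk k|%:R) in
  exists T0 : nat, forall T : nat, (T0 <= T)%N ->
  exists2 p : params R V m, valid_params s blk p &
  forall ell : nat -> V -> R,
    (forall (t : nat) (v : V), (t < T)%N -> 0 <= ell t v <= 1) ->
  forall a : V,
  let Reg := regret E s blk p ell T a in
  let T13 : R := T%:R `^ (1 / 3) in
  let T12 : R := T%:R `^ (1 / 2) in
  let T23 : R := T%:R `^ (2 / 3) in
  [/\ (U2 = finset.set0 -> U1NS = finset.set0 ->
         Reg <= 2 * Num.sqrt (2 * u1S) * T12),
      (U2 = finset.set0 -> U1NS <> finset.set0 ->
         Reg <= 4 * Num.sqrt (6 * u1S) * T12
              + 2 * Num.sqrt (10 * ln (u1NS + 1)) * T12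
              + T12),
      (U2 <> finset.set0 -> U1NS = finset.set0 ->
         Reg <= 3 * 2 `^ (2 / 3) * (u2 * D2) `^ (1 / 6) * T23
              + 3 / 2 `^ (1 / 3) * Dlog `^ (1 / 3) * T23
              + 4 * Num.sqrt u1S * T12)
    & (U2 <> finset.set0 -> U1NS <> finset.set0 ->
         Reg <= 6 * 2 `^ (1 / 3) * (u2 * D2) `^ (1 / 6) * T23
              + 3 / 2 `^ (1 / 3) * Dlog `^ (1 / 3) * T23
              + Num.sqrt 6 / 3 * T12
              + 4 * Num.sqrt (6 * u1S) * T12
              + 2 * Num.sqrt (10 * ln (u1NS + 1)) * T12
              + 4 * T13 * u2 `^ (5 / 6) / (2 `^ (1 / 3) * D2 `^ (1 / 6)))].
Proof.
move=> U2 U1S U1NS delta u2 u1S u1NS D2 Dlog.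
(* The case depends only on the graph and its partition, so [T0] and the parameters may be chosen by
   case, before the losses and the arm. *)
have [U20|U20] := eqVneq U2 finset.set0; have [N0|N0] := eqVneq U1NS finset.set0.
- exists 1%N => T T0; have [p pv rb] := @tuned_loops R V m E s blk legal T T0 U20 N0.
  exists p => // ell ell01 a Reg T13 T12 T23; split => // _ _.
  exact: rb.
- have [T0 hT] := @tuned_strong R V m E s blk legal U20 N0.
  exists T0 => T /hT[p pv rb]; exists p => // ell ell01 a Reg T13 T12 T23.
  split => //; [by move=> _ /eqP; rewrite (negPf N0)|by move=> _ _; exact: rb].
- have [T0 hT] := @tuned_U2 R V m E s blk legal U20 N0.
  exists T0 => T /hT[p pv rb]; exists p => // ell ell01 a Reg T13 T12 T23.
  split => //; first by move=> /eqP; rewrite (negPf U20).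
  by move=> _ _; exact: rb.
have [T0 hT] := @tuned_U2_strong R V m E s blk legal U20 N0.
exists T0 => T /hT[p pv rb]; exists p => // ell ell01 a Reg T13 T12 T23.
split; [by move=> /eqP; rewrite (negPf U20)|by move=> /eqP; rewrite (negPf U20)
  |by move=> _ /eqP; rewrite (negPf N0)|move=> _ _].
apply: le_trans (rb ell ell01 a) _.
(* The goal exceeds the bound just obtained by two nonnegative lower-order terms. *)
have h1 : 0 <= Num.sqrt 6 / 3 * T12 by rewrite mulr_ge0 ?divr_ge0 ?powR_ge0 ?sqrtr_ge0.
have h2 : 0 <= 4 * T13 * u2 `^ (5 / 6) / (2 `^ (1 / 3) * D2 `^ (1 / 6)).
  by rewrite divr_ge0 ?mulr_ge0 ?powR_ge0.
rewrite -/U2 -/U1S -/U1NS -/T12 -/T23; lra.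
Qed.
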